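(* Let $n\wedge p\wedge q\to\infty$. Suppose that there are constants $a,b,a',b'$ not depending on $p,q$ with $0<a\le\inf_i \mathrm{var}(x_i)\le\sup_iE(x_i^2)\le b<\infty$ and $0<a'\le\inf_j \mathrm{var}(y_j)\le\sup_jE(y_j^2)\le b'<\infty$. (i) One has $$dCov_n^2(\mathbf X,\mathbf Y)=\frac1\tau\sum_{i=1}^p\sum_{j=1}^q\mathrm{cov}_n^2(\mathcal X_i,\mathcal Y_j)+\mathcal R_n,$$ where $\mathcal R_n$ is the remainder term (defined by this identity). (ii) Write $E[L_X(X,X')^2]=\alpha_p^2$, $E[L_Y(Y,Y')^2]=\beta_q^2$, $E[L_X(X,X')^4]=\gamma_p^2$, $E[L_Y(Y,Y')^4]=\lambda_q^2$ (with $\alpha_p,\beta_q,\gamma_p,\lambda_q\ge0$), and suppose further that, as $n\wedge p\wedge q\to\infty$: $n\alpha_p=o(1)$, $n\beta_q=o(1)$, $\tau_X^2(\alpha_p\gamma_p+\gamma_p^2)=o(1)$, $\tau_Y^2(\beta_q\lambda_q+\lambda_q^2)=o(1)$, $\tau(\alpha_p\lambda_q+\gamma_p\beta_q+\gamma_p\lambda_q)=o(1)$. Then $$\frac1\tau\sum_{i=1}^p\sum_{j=1}^q\mathrm{cov}_n^2(\mathcal X_i,\mathcal Y_j)=O_p(\tau\alpha_p\beta_q),\qquad \mathcal R_n=O_p(\tau\alpha_p\lambda_q+\tau\gamma_p\beta_q+\tau\gamma_p\lambda_q)=o_p(1).$$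
   Context: Setting. For each $p,q$, $(X,Y)$ is a pair of random vectors $X=(x_1,\dots,x_p)^T\in\mathbb R^p$, $Y=(y_1,\dots,y_q)^T\in\mathbb R^q$ (whose law may depend on $p,q$). $(X_1,Y_1),\dots,(X_n,Y_n)$ are i.i.d. copies of $(X,Y)$, with $X_s=(x_{s1},\dots,x_{sp})^T$, $Y_s=(y_{s1},\dots,y_{sq})^T$; $\mathbf X=(X_1,\dots,X_n)^T$, $\mathbf Y=(Y_1,\dots,Y_n)^T$; $\mathcal X_i=(x_{1i},\dots,x_{ni})^T$, $\mathcal Y_j=(y_{1j},\dots,y_{nj})^T$. $|\cdot|$ is the Euclidean norm; $(X',Y')$ is an independent copy of $(X,Y)$. $\mathcal U$-centering. For an $n\times n$ matrix $\mathbf A=(a_{st})$ with zero diagonal, $\widetilde{\mathbf A}=(\tilde a_{st})$ has $\tilde a_{ss}=0$ and, for $s\neq t$, $\tilde a_{st}=a_{st}-\frac1{n-2}\sum_{v}a_{sv}-\frac1{n-2}\sum_{u}a_{ut}+\frac1{(n-1)(n-2)}\sum_{u,v}a_{uv}$; $(\widetilde{\mathbf A}\cdot\widetilde{\mathbf B})=\frac1{n(n-3)}\sum_{s\ne t}\tilde a_{st}\tilde b_{st}$. $dCov_n^2(\mathbf X,\mathbf Y)=(\widetilde{\mathbf A}\cdot\widetilde{\mathbf B})$ with $a_{st}=|X_s-X_t|$, $b_{st}=|Y_s-Y_t|$. $\mathrm{cov}_n^2(\mathcal X_i,\mathcal Y_j)=\binom n4^{-1}\sum_{s<t<u<v}\frac1{4!}\sum_*\frac14(x_{si}-x_{ti})(y_{sj}-y_{tj})(x_{ui}-x_{vi})(y_{uj}-y_{vj})$,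 where $\sum_*$ is over all permutations of the indices $(s,t,u,v)$. Notation: $\tau_X^2=E|X-X'|^2$, $\tau_Y^2=E|Y-Y'|^2$, $\tau=\tau_X\tau_Y$; $L_X(X,X')=\frac{|X-X'|^2-\tau_X^2}{\tau_X^2}$, $L_Y(Y,Y')=\frac{|Y-Y'|^2-\tau_Y^2}{\tau_Y^2}$. *)

(* Defs.v *)
From HB Require Import structures.
From mathcomp Require Import all_boot all_order all_algebra all_fingroup.
From mathcomp Require Import all_classical all_reals all_analysis.

Set Implicit Arguments.
Unset Strict Implicit.
Unset Printing Implicit Defensive.
Import Order.TTheory GRing.Theory Num.Theory.
Import numFieldNormedType.Exports.

Local Open Scope classical_set_scope.
Local Open Scope ring_scope.

(* |u - v| for the Euclidean norm; R^m is [m.-tuple R], whose library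
   sigma-algebra is the one generated by the coordinates, i.e. the Borel one. *)
Definition eucl_dist (R : realType) (m : nat) (u v : m.-tuple R) : R :=
  Num.sqrt (\sum_(i < m) (tnth u i - tnth v i) ^+ 2).

Definition Ucenter (R : realType) (n : nat) (A : 'M[R]_n) : 'M[R]_n :=
  \matrix_(s, t)
    if s == t then 0 else
      A s t
      - (n%:R - 2)^-1 * \sum_v A s v
      - (n%:R - 2)^-1 * \sum_u A u t
      + ((n%:R - 1) * (n%:R - 2))^-1 * \sum_u \sum_v A u v.

Definition Uinner (R : realType) (n : nat) (A B : 'M[R]_n) : R :=
  (n%:R * (n%:R - 3))^-1 * \sum_s \sum_(t | s != t) A s t * B s t.

Definition dist_mx (R : realType) (n m : nat) (x : 'I_n -> m.-tuple R) : 'M[R]_n :=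
  \matrix_(s, t) eucl_dist (x s) (x t).

Definition dCov2 (R : realType) (n p q : nat)
    (x : 'I_n -> p.-tuple R) (y : 'I_n -> q.-tuple R) : R :=
  Uinner (Ucenter (dist_mx x)) (Ucenter (dist_mx y)).

Definition cov_kernel (R : realType) (n : nat) (x y : 'I_n -> R)
    (s t u v : 'I_n) : R :=
  4^-1 * ((x s - x t) * (y s - y t) * (x u - x v) * (y u - y v)).

(* [w] lists (s, t, u, v); [sg] runs over all the reorderings of its entries. *)
Definition cov_sym_kernel (R : realType) (n : nat) (x y : 'I_n -> R)
    (w : 4.-tuple 'I_n) : R :=
  (4`!)%:R^-1 * \sum_(sg : 'S_4)
    cov_kernel x y (tnth w (sg (inord 0))) (tnth w (sg (inord 1)))
                   (tnth w (sg (inord 2))) (tnth w (sg (inord 3))).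

Definition cov2 (R : realType) (n : nat) (x y : 'I_n -> R) : R :=
  ('C(n, 4))%:R^-1 *
  \sum_(s < n) \sum_(t < n) \sum_(u < n) \sum_(v < n | (s < t < u)%N && (u < v)%N)
    cov_sym_kernel x y [tuple s; t; u; v].

Definition sum_cov2 (R : realType) (n p q : nat)
    (x : 'I_n -> p.-tuple R) (y : 'I_n -> q.-tuple R) : R :=
  \sum_(i < p) \sum_(j < q) cov2 (fun s => tnth (x s) i) (fun s => tnth (y s) j).

Section probability_notions.
Context (R : realType).

Definition same_distribution d d' d'' (T : measurableType d) (T' : measurableType d')
    (V : measurableType d'') (P : probability T R) (P' : probability T' R)
    (Z : {RV P >-> V}) (Z' : {RV P' >-> V}) : Prop :=
  forall A : set V, measurable A -> distribution P Z A = distribution P' Z' A.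

Definition independent2 d d' (T : measurableType d) (V : measurableType d')
    (P : probability T R) (Z Z' : {RV P >-> V}) : Prop :=
  forall A B : set V, measurable A -> measurable B ->
    P ((Z @^-1` A) `&` (Z' @^-1` B)) = (P (Z @^-1` A) * P (Z' @^-1` B))%E.

Definition independent_copy d d' (T : measurableType d) (V : measurableType d')
    (P : probability T R) (Z Z' : {RV P >-> V}) : Prop :=
  independent2 Z Z' /\ same_distribution Z' Z.

(* The product rule over the whole family gives it over every subfamily, since
   any [A s] may be the full space. *)
Definition mutually_independent d d' (T : measurableType d) (V : measurableType d')
    (P : probability T R) (n : nat) (Z : 'I_n -> {RV P >-> V}) : Prop :=
  forall A : 'I_n -> set V, (forall s, measurable (A s)) ->
    P [set w | forall s, A s (Z s w)] = (\prod_(s < n) P (Z s @^-1` A s))%E.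

Definition iid_copies d d' d'' (T : measurableType d) (T' : measurableType d')
    (V : measurableType d'') (P : probability T R) (P' : probability T' R) (n : nat)
    (Zs : 'I_n -> {RV P >-> V}) (Z : {RV P' >-> V}) : Prop :=
  mutually_independent Zs /\ forall s, same_distribution (Zs s) Z.

(* E|U - U'|^2 *)
Definition tau2 d (T : measurableType d) (P : probability T R) (m : nat)
    (U U' : T -> m.-tuple R) : R :=
  fine 'E_P[(fun w => eucl_dist (U w) (U' w) ^+ 2)%R].

Definition relL d (T : measurableType d) (P : probability T R) (m : nat)
    (U U' : T -> m.-tuple R) (w : T) : R :=
  (eucl_dist (U w) (U' w) ^+ 2 - tau2 P U U') / tau2 P U U'.

(* Z_k = O_p(r_k) and Z_k = o_p(1) as k --> oo; each Z_k may live on its own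
   probability space. Where r_k = 0, O_p(r_k) means 0 up to small probability. *)
Definition bigOp (d : nat -> measure_display) (T : forall k, measurableType (d k))
    (P : forall k, probability (T k) R) (Z : forall k, T k -> R) (r : nat -> R) : Prop :=
  forall eps : R, 0 < eps -> exists M : R,
    \forall k \near \oo, (P k [set w | (M * `|r k| < `|Z k w|)%R] <= eps%:E)%E.

Definition littleop1 (d : nat -> measure_display) (T : forall k, measurableType (d k))
    (P : forall k, probability (T k) R) (Z : forall k, T k -> R) : Prop :=
  forall eps : R, 0 < eps ->
    (P k [set w | (eps < `|Z k w|)%R]) @[k --> \oo] --> 0%E.

End probability_notions.

(* Main.v *)
(* Write |X_s - X_t| = tau_X (1 + L/2 + R), with L = L_X(X_s, X_t) and
   |R| <= L^2 / 2.  U-centering is linear, kills off-diagonal constants and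
   does not increase the sum of squared entries; the covariance term is exactly
   tau/4 times the inner product of the U-centered matrices of L_X and L_Y, and
   the remainder is tau times a combination of the inner products (L, R), (R, L)
   and (R, R).  By Cauchy-Schwarz these are controlled by the sums over s, t of
   L_X^2, L_Y^2, L_X^4 and L_Y^4, and Markov's inequality keeps each of the four
   sums below K times its expectation with probability at least 1 - 1/K. *)
Require Import Defs.
From HB Require Import structures.
From mathcomp Require Import all_boot all_order all_algebra all_fingroup.
From mathcomp Require Import all_classical all_reals all_analysis.
From mathcomp Require Import measurable_realfun ring lra.

Set Implicit Arguments.
Unset Strict Implicit.
Unset Printing Implicit Defensive.
Import Order.TTheory GRing.Theory Num.Theory.
Import numFieldNormedType.Exports.

Local Open Scope classical_set_scope.
Local Open Scope ring_scope.

(** * U-centering *)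

(** Beyond the exact identity, every estimate is Cauchy-Schwarz, so X and Y may be dependent: each
    of the four sums involves only one of the two vectors, and its mean needs only the law of a pair
    (X_s, X_t) with s <> t, which is that of (X, X'). The exact identity for the covariance term is
    the algebraic obstacle, since cov_n^2 is a symmetrised sum over increasing quadruples while the
    inner product runs over U-centered entries. Symmetrisation replaces increasing quadruples by
    quadruples of distinct indices, inclusion-exclusion replaces these by unrestricted sums, and
    both sides become polynomials in the sums of x^i y^j with i, j <= 2, which can be compared
    mechanically. The moment bounds on the coordinates allow division by tau_X^2 and tau_Y^2: the
    variances make them positive and the second moments make them finite, whereas [fine] would turn
    an infinite expectation into 0. *)

Section Ucentering.
Context (R : realType) (n : nat).
Implicit Types A B : 'M[R]_n.

Lemma UcenterE A s t : s != t ->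
  Ucenter A s t = A s t - (n%:R - 2)^-1 * \sum_v A s v
    - (n%:R - 2)^-1 * \sum_u A u t
    + ((n%:R - 1) * (n%:R - 2))^-1 * \sum_u \sum_v A u v.
Proof. by move=> st; rewrite mxE (negbTE st). Qed.

Lemma Ucenter_linear : linear (@Ucenter R n).
Proof.
move=> k A B; apply/matrixP => s t; rewrite !mxE.
case: eqP => _; first by rewrite mulr0 addr0.
have sumE (I : finType) (f g h : I -> R) :
    (forall i, h i = k * f i + g i) -> \sum_i h i = k * (\sum_i f i) + \sum_i g i.
  by move=> E; rewrite mulr_sumr -big_split; apply: eq_bigr.
rewrite (sumE _ (A s) (B s) ((k *: A + B) s)); last by move=> v; rewrite !mxE.
rewrite (sumE _ (A^~ t) (B^~ t) ((k *: A + B)^~ t)); last by move=> v; rewrite !mxE.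
rewrite (sumE _ (fun u => \sum_v A u v) (fun u => \sum_v B u v)
  (fun u => \sum_v (k *: A + B) u v)); first by ring.
by move=> u; apply: sumE => v; rewrite !mxE.
Qed.

HB.instance Definition _ :=
  GRing.isLinear.Build R 'M[R]_n 'M[R]_n _ (@Ucenter R n) Ucenter_linear.

Lemma UinnerDl A A' B : Uinner (A + A') B = Uinner A B + Uinner A' B.
Proof.
rewrite /Uinner -mulrDr -big_split; congr (_ * _); apply: eq_bigr => s _ /=.
by rewrite -big_split; apply: eq_bigr => t _; rewrite mxE mulrDl.
Qed.

Lemma UinnerC A B : Uinner A B = Uinner B A.
Proof.
by congr (_ * _); apply: eq_bigr => s _; apply: eq_bigr => t _; rewrite mulrC.
Qed.

Lemma UinnerDr A B B' : Uinner A (B + B') = Uinner A B + Uinner A B'.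
Proof. by rewrite UinnerC UinnerDl !(UinnerC A). Qed.

Lemma UinnerZl k A B : Uinner (k *: A) B = k * Uinner A B.
Proof.
rewrite /Uinner mulrCA; congr (_ * _); rewrite mulr_sumr; apply: eq_bigr => s _.
by rewrite mulr_sumr; apply: eq_bigr => t _; rewrite mxE mulrA.
Qed.

Lemma UinnerZr k A B : Uinner A (k *: B) = k * Uinner A B.
Proof. by rewrite UinnerC UinnerZl UinnerC. Qed.

Lemma Uinner_suml I (r : seq I) (F : I -> 'M[R]_n) B :
  Uinner (\sum_(i <- r) F i) B = \sum_(i <- r) Uinner (F i) B.
Proof.
elim/big_rec2: _ => [|i x M _ <-]; last by rewrite UinnerDl.
by rewrite -(scale0r (0 : 'M[R]_n)) UinnerZl mul0r.
Qed.

Lemma Uinner_sumr I (r : seq I) (F : I -> 'M[R]_n) A :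
  Uinner A (\sum_(i <- r) F i) = \sum_(i <- r) Uinner A (F i).
Proof. by rewrite UinnerC Uinner_suml; under eq_bigr do rewrite UinnerC. Qed.

(** The zero diagonal matters: a nonzero constant matrix with its diagonal kept is not annihilated
    by U-centering, which would send it off the diagonal to -k / (n - 1). *)
Definition offdiag (f : 'I_n -> 'I_n -> R) : 'M[R]_n :=
  \matrix_(s, t) if s == t then 0 else f s t.

Hypothesis n4 : (4 <= n)%N.

Lemma natn_gt k : (k < 4)%N -> (k%:R : R) < n%:R.
Proof. by move=> k4; rewrite ltr_nat (leq_trans k4). Qed.

(** Rows and columns sum to (n - 1) k and the whole matrix to n (n - 1) k, so an off-diagonal entry
    becomes k (1 - 2 (n - 1) / (n - 2) + n / (n - 2)) = 0. *)
Lemma Ucenter_offdiag_cst k : Ucenter (offdiag (fun _ _ => k)) = 0.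
Proof.
have n2 := @natn_gt 2 isT; have n1 := @natn_gt 1 isT.
have rowE s : \sum_v offdiag (fun _ _ => k) s v = (n%:R - 1) * k.
  rewrite (bigD1 s) //= mxE eqxx add0r.
  rewrite (eq_bigr (fun=> k)) => [|v vs]; last by rewrite mxE eq_sym (negbTE vs).
  rewrite sumr_const cardC1 card_ord -[LHS]mulr_natl -subn1 natrB //.
  by rewrite (leq_trans _ n4).
have colE t : \sum_u offdiag (fun _ _ => k) u t = (n%:R - 1) * k.
  by rewrite -(rowE t); apply: eq_bigr => v _; rewrite !mxE eq_sym.
apply/matrixP => s t; rewrite !mxE; case: eqP => // _.
rewrite rowE colE; under eq_bigr do rewrite rowE.
rewrite sumr_const card_ord -mulr_natl.
by field; apply/andP; split; lra.
Qed.

(** Up to the factor 1 / (n (n - 3)), the three-term form of the unbiased distance covariance, in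
    terms of the entries before centering: entrywise products, totals and row sums. *)
Definition Uform (A B : 'M[R]_n) : R :=
  \sum_s \sum_t A s t * B s t
  + ((n%:R - 1) * (n%:R - 2))^-1 * ((\sum_s \sum_t A s t) * (\sum_s \sum_t B s t))
  - 2 * (n%:R - 2)^-1 * \sum_s (\sum_t A s t) * (\sum_t B s t).

Lemma sum_Ucenter_mul A B :
  (forall s t, A s t = A t s) -> (forall s t, B s t = B t s) ->
  (forall s, A s s = 0) -> (forall s, B s s = 0) ->
  \sum_s \sum_(t | s != t) Ucenter A s t * Ucenter B s t = Uform A B.
Proof.
move=> symA symB A0 B0; rewrite /Uform.
have n2 := @natn_gt 2 isT; have n1 := @natn_gt 1 isT.
pose a s := \sum_t A s t; pose b s := \sum_t B s t.
pose SA := \sum_s a s; pose SB := \sum_s b s; pose D := \sum_s a s * b s.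
set AB := \sum_s \sum_t A s t * B s t.
rewrite -/D -/SA -/SB.
set c := (n%:R - 2)^-1; set e := ((n%:R - 1) * (n%:R - 2))^-1.
(* [p s] is the part of the centering of row [s] that does not depend on the column; by symmetry of
   [A] the centered entry is [A s t + p s - c * a t]. *)
pose p s := e * SA - c * a s; pose q s := e * SB - c * b s.
have colA t : \sum_u A u t = a t by apply: eq_bigr => u _.
have colB t : \sum_u B u t = b t by apply: eq_bigr => u _.
have rowE s : \sum_(t | s != t) Ucenter A s t * Ucenter B s t =
    \sum_t A s t * B s t + q s * a s + p s * b s + n%:R * (p s * q s)
    - c * \sum_t A s t * b t - c * \sum_t a t * B s t
    - c * p s * SB - c * q s * SA + c ^+ 2 * D - (p s - c * a s) * (q s - c * b s).
  (* The sum is completed to t = s, where the zero diagonal leaves [p s - c * a s] and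
     [q s - c * b s]; their product is subtracted again. *)
  transitivity (\sum_t (A s t + p s - c * a t) * (B s t + q s - c * b t)
                - (p s - c * a s) * (q s - c * b s)).
    rewrite [X in X - _](bigD1 s) //= A0 B0 !add0r addrAC subrr add0r.
    apply: eq_big => [t|t st]; first by rewrite eq_sym.
    by rewrite !UcenterE // -/(a s) -/(b s) colA colB -/c -/e -/SA -/SB /p /q; ring.
  congr (_ - _).
  transitivity (\sum_t (A s t * B s t + q s * A s t + p s * B s t + p s * q s
    - c * (A s t * b t) - c * (a t * B s t) - c * p s * b t - c * q s * a t
    + c ^+ 2 * (a t * b t))).
    by apply: eq_bigr => t _; ring.
  rewrite !(big_split, sumrN) /= -!mulr_sumr sumr_const card_ord mulr_natl.
  by rewrite /D /SA /SB mulrnAr.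
rewrite (eq_bigr _ (fun s _ => rowE s)).
have crossA : \sum_s \sum_t A s t * b t = D.
  by rewrite exchange_big; apply: eq_bigr => t _; rewrite -mulr_suml colA.
have crossB : \sum_s \sum_t a t * B s t = D.
  by rewrite exchange_big; apply: eq_bigr => t _; rewrite -mulr_sumr colB.
(* [k] gathers the terms that do not depend on [s]; as an opaque variable it is not taken apart by
   [big_split]. *)
have [k kE] : exists k, k = n%:R * e ^+ 2 * (SA * SB) - 2 * c * e * (SA * SB)
  + c ^+ 2 * D - e ^+ 2 * SA * SB by eexists.
transitivity (\sum_s (\sum_t A s t * B s t - c * (\sum_t A s t * b t)
   - c * (\sum_t a t * B s t) + k
   + (e - n%:R * (e * c) + c ^+ 2 + 2 * c * e) * SB * a s
   + (e - n%:R * (e * c) + c ^+ 2 + 2 * c * e) * SA * b s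
   + (- 2 * c + n%:R * c ^+ 2 - 4 * c ^+ 2) * (a s * b s))).
  by apply: eq_bigr => s _; rewrite /p /q kE; ring.
rewrite !(big_split, sumrN) /= -!mulr_sumr crossA crossB.
rewrite sumr_const card_ord -[k *+ n]mulr_natl kE -/SA -/SB -/D -/AB /e /c.
by field; apply/andP; split; lra.
Qed.

Lemma UinnerE A B :
  (forall s t, A s t = A t s) -> (forall s t, B s t = B t s) ->
  (forall s, A s s = 0) -> (forall s, B s s = 0) ->
  Uinner (Ucenter A) (Ucenter B) = (n%:R * (n%:R - 3))^-1 * Uform A B.
Proof. by move=> *; rewrite /Uinner sum_Ucenter_mul. Qed.

End Ucentering.

(** * The covariance U-statistic *)

Section Sorted_tuples.
Context (R : realType) (n : nat).

Definition ord_lt (i j : 'I_n) := (i < j)%N.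
Definition perm_tuple m (w : m.-tuple 'I_n) (sg : 'S_m) : m.-tuple 'I_n :=
  [tuple tnth w (sg i) | i < m].

Lemma perm_tupleK m (sg : 'S_m) : cancel ((@perm_tuple m)^~ sg) ((@perm_tuple m)^~ (sg^-1)%g).
Proof. by move=> w; apply: eq_from_tnth => i; rewrite !tnth_mktuple permKV. Qed.

Lemma perm_eq_perm_tuple m (w : m.-tuple 'I_n) (sg : 'S_m) : perm_eq (perm_tuple w sg) w.
Proof. by apply/tuple_permP; exists sg. Qed.

(** A strictly increasing list has no repetition, so a repeated entry excludes every [sg]. Distinct
    entries admit exactly one: sorting provides it, and two permutations giving the same tuple agree
    because [tnth w] is injective. *)
Lemma sum_sorted_perm_tuple m (w : m.-tuple 'I_n) :
  \sum_(sg : 'S_m) (sorted ord_lt (perm_tuple w sg))%:R = (uniq w)%:R :> R.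
Proof.
have lt_trans : transitive ord_lt by move=> j i k; apply: ltn_trans.
have lt_irr : irreflexive ord_lt by move=> i; apply: ltnn.
case: (boolP (uniq w)) => [uw|nuw]; last first.
  rewrite big1 // => sg _; case: (boolP (sorted _ _)) => // /(sorted_uniq lt_trans lt_irr).
  by rewrite (perm_uniq (perm_eq_perm_tuple w sg)) (negbTE nuw).
(* Sorting needs a total relation, hence the weak order; distinctness of the entries then makes the
   result strictly increasing. *)
pose le (i j : 'I_n) := (i <= j)%N.
have le_total : total le by move=> i j; apply: leq_total.
have : perm_eq (sort le w) w by rewrite perm_sort.
move=> /tuple_permP[sg0 sg0E].
have srt0 : sorted ord_lt (perm_tuple w sg0).
  have : sorted le (perm_tuple w sg0) by rewrite -sg0E sort_sorted.
  have : uniq (perm_tuple w sg0) by rewrite (perm_uniq (perm_eq_perm_tuple w sg0)).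
  have relE (r : rel nat) s : sorted (relpre val r) s = sorted r (map (val : 'I_n -> nat) s).
    by rewrite sorted_map.
  rewrite -(map_inj_uniq (val_inj : injective (val : 'I_n -> nat))).
  rewrite (relE leq) (relE ltn).
  by rewrite ltn_sorted_uniq_leq => -> ->.
rewrite (bigD1 sg0) //= srt0 big1 ?addr0 // => sg sgN; case: (boolP (sorted _ _)) => // srt.
have E : perm_tuple w sg = perm_tuple w sg0.
  apply/val_inj/(irr_sorted_eq lt_trans lt_irr srt srt0)/perm_mem.
  by rewrite (perm_trans (perm_eq_perm_tuple w sg)) // perm_sym perm_eq_perm_tuple.
case/eqP: sgN; apply/permP => i.
move/(congr1 (fun w => tnth w i)): E; rewrite !tnth_mktuple.
by move/tuple_uniqP: uw; apply.
Qed.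

(** This removes the constraint s < t < u < v from the U-statistic. Reindexing the tuples for each
    fixed [sg] gives [F w] a weight equal to the number of increasing rearrangements of [w]. *)
Lemma sum_sorted_tuples m (F : m.-tuple 'I_n -> R) :
  \sum_(w : m.-tuple 'I_n | sorted ord_lt w) \sum_(sg : 'S_m) F (perm_tuple w sg) =
  \sum_(w : m.-tuple 'I_n | uniq w) F w.
Proof.
rewrite exchange_big /=.
have E sg : \sum_(w : m.-tuple 'I_n | sorted ord_lt w) F (perm_tuple w sg) =
    \sum_(w : m.-tuple 'I_n) (sorted ord_lt (perm_tuple w (sg^-1)%g))%:R * F w.
  rewrite (reindex_onto ((@perm_tuple m)^~ (sg^-1)%g) ((@perm_tuple m)^~ sg)) /= => [|w _]; last first.
    exact: perm_tupleK.
  rewrite big_mkcond; apply: eq_bigr => w _ /=.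
  have := perm_tupleK (sg^-1)%g w; rewrite invgK => ->; rewrite eqxx andbT.
  by case: ifP; rewrite ?mul1r ?mul0r.
rewrite (eq_bigr _ (fun sg _ => E sg)) exchange_big [RHS]big_mkcond.
apply: eq_bigr => w _; rewrite -mulr_suml.
rewrite (reindex_inj invg_inj) /=.
under eq_bigr do rewrite invgK.
by rewrite sum_sorted_perm_tuple; case: ifP; rewrite ?mul1r ?mul0r.
Qed.

Lemma sum_tuple4 (P : pred (4.-tuple 'I_n)) (F : 4.-tuple 'I_n -> R) :
  \sum_(w : 4.-tuple 'I_n | P w) F w =
  \sum_s \sum_t \sum_u \sum_(v | P [tuple s; t; u; v]) F [tuple s; t; u; v].
Proof.
under [RHS]eq_bigr => s _.
  under eq_bigr => t _ do (under eq_bigr do rewrite big_mkcond /=; rewrite pair_big /=).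
  rewrite pair_big /=.
  over.
rewrite pair_big [LHS]big_mkcond /=.
apply: (reindex (fun i : 'I_n * ('I_n * ('I_n * 'I_n)) => [tuple i.1; i.2.1; i.2.2.1; i.2.2.2])).
exists (fun w => (tnth w (inord 0), (tnth w (inord 1), (tnth w (inord 2), tnth w (inord 3))))).
  by move=> [s [t [u v]]] _; rewrite !(tnth_nth s) /= !inordK.
move=> w _; apply: eq_from_tnth => i; rewrite [LHS](tnth_nth (tnth w ord0)).
rewrite -[in RHS](inord_val i).
by case: (nat_of_ord i) (ltn_ord i) => [|[|[|[|k]]]].
Qed.

(** Inclusion-exclusion. Since [h] vanishes on the diagonal, terms with s = t or u = v are zero
    anyway, and only coincidences between {s, t} and {u, v} remain: the four single ones are
    subtracted, and the two double ones, (u, v) = (s, t) and (u, v) = (t, s), are added back after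
    being subtracted twice. *)
Lemma sum_uniq4 (h : 'I_n -> 'I_n -> R) :
  (forall s t, h s t = h t s) -> (forall s, h s s = 0) ->
  \sum_s \sum_t \sum_u \sum_(v | uniq [:: s; t; u; v]) h s t * h u v =
  (\sum_s \sum_t h s t) ^+ 2 - 4 * \sum_s (\sum_t h s t) ^+ 2
    + 2 * \sum_s \sum_t h s t ^+ 2.
Proof.
move=> hC h0.
pose rs s := \sum_t h s t.
have pick (f : 'I_n -> R) s : \sum_u (s == u)%:R * f u = f s.
  rewrite (bigD1 s) //= eqxx mul1r big1 ?addr0 // => u; rewrite eq_sym => /negbTE ->.
  by rewrite mul0r.
have E s t : \sum_u \sum_(v | uniq [:: s; t; u; v]) h s t * h u v =
    h s t * ((\sum_u rs u) - 2 * rs s - 2 * rs t + 2 * h s t).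
  transitivity (\sum_u \sum_v h s t * (h u v - (s == u)%:R * h u v - (s == v)%:R * h u v
     - (t == u)%:R * h u v - (t == v)%:R * h u v
     + (s == u)%:R * ((t == v)%:R * h u v) + (t == u)%:R * ((s == v)%:R * h u v))).
    apply: eq_bigr => u _; rewrite big_mkcond; apply: eq_bigr => v _ /=.
    rewrite !inE !andbT.
    have [->|st] := eqVneq s t; first by rewrite h0 !mul0r ?if_same.
    have [->|uv] := eqVneq u v; first by rewrite h0 !mulr0 ?if_same; ring.
    case: (eqVneq s u) => su; case: (eqVneq s v) => sv;
      case: (eqVneq t u) => tu; case: (eqVneq t v) => tv; rewrite /=;
      first [ring | by subst; rewrite eqxx in st | by subst; rewrite eqxx in uv].
  under eq_bigr do rewrite -mulr_sumr.
  rewrite -mulr_sumr; congr (_ * _).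
  under eq_bigr do rewrite !(big_split, sumrN) /= -!mulr_sumr !pick.
  rewrite !(big_split, sumrN) /= !pick.
  have cE v : \sum_i h i v = rs v by apply: eq_bigr.
  by rewrite !cE (hC t s) -!/(rs _); ring.
under eq_bigr do under eq_bigr do rewrite E.
transitivity (\sum_s \sum_t ((\sum_u rs u) * h s t - 2 * (rs s * h s t)
   - 2 * (h s t * rs t) + 2 * h s t ^+ 2)).
  by apply: eq_bigr => s _; apply: eq_bigr => t _; ring.
under eq_bigr do rewrite !(big_split, sumrN) /= -!mulr_sumr.
rewrite !(big_split, sumrN) /= -!mulr_sumr.
have -> : \sum_s \sum_t h s t * rs t = \sum_s rs s * rs s.
  rewrite exchange_big; apply: eq_bigr => t _ /=; rewrite -mulr_suml.
  by congr (_ * _); apply: eq_bigr.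
rewrite -/(rs _).
have -> : \sum_s (\sum_t h s t) ^+ 2 = \sum_s rs s * rs s.
  by apply: eq_bigr => s _; rewrite expr2.
have -> : \sum_s \sum_t h s t = \sum_s rs s by [].
ring.
Qed.

(** The kernel is [h s t * h u v] divided by 4, so [sum_uniq4] applies once the order is removed;
    'C(n, 4) times 4! is the falling factorial n (n - 1) (n - 2) (n - 3). *)
Lemma cov2E (x y : 'I_n -> R) : (4 <= n)%N ->
  let h s t := (x s - x t) * (y s - y t) in
  cov2 x y = (4 * (n%:R * (n%:R - 1) * (n%:R - 2) * (n%:R - 3)))^-1 *
    ((\sum_s \sum_t h s t) ^+ 2 - 4 * (\sum_s (\sum_t h s t) ^+ 2)
    + 2 * \sum_s \sum_t h s t ^+ 2).
Proof.
move=> n4 h; rewrite /cov2 /cov_sym_kernel.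
pose F (w : 4.-tuple 'I_n) := cov_kernel x y (tnth w (inord 0)) (tnth w (inord 1))
   (tnth w (inord 2)) (tnth w (inord 3)).
have -> : \sum_(s < n) \sum_(t < n) \sum_(u < n)
    \sum_(v < n | (s < t < u)%N && (u < v)%N)
      ((4`!)%:R^-1 : R) * \sum_(sg : 'S_4) cov_kernel x y
      (tnth [tuple s; t; u; v] (sg (inord 0))) (tnth [tuple s; t; u; v] (sg (inord 1)))
      (tnth [tuple s; t; u; v] (sg (inord 2))) (tnth [tuple s; t; u; v] (sg (inord 3)))
    = (4`!)%:R^-1 * (4^-1 * ((\sum_s \sum_t h s t) ^+ 2 - 4 * (\sum_s (\sum_t h s t) ^+ 2)
    + 2 * \sum_s \sum_t h s t ^+ 2)).
  rewrite -sum_uniq4 => [|s t|s]; rewrite /h; [|by ring|by ring].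
  transitivity (\sum_(w : 4.-tuple 'I_n | sorted ord_lt w)
     (4`!)%:R^-1 * \sum_(sg : 'S_4) F (perm_tuple w sg)).
    rewrite sum_tuple4; apply: eq_bigr => s _; apply: eq_bigr => t _.
    apply: eq_bigr => u _; apply: eq_big => [v|v _].
      by rewrite /= /ord_lt andbT -andbA.
    by congr (_ * _); apply: eq_bigr => sg _; rewrite /F !tnth_mktuple.
  rewrite -mulr_sumr sum_sorted_tuples; congr (_ * _).
  rewrite sum_tuple4 mulr_sumr; apply: eq_bigr => s _.
  rewrite mulr_sumr; apply: eq_bigr => t _; rewrite mulr_sumr; apply: eq_bigr => u _.
  rewrite mulr_sumr; apply: eq_bigr => v _.
  rewrite /F /cov_kernel !(tnth_nth s) /= !inordK //=.
  by ring.
have cE : ('C(n, 4))%:R * (4`!)%:R = n%:R * (n%:R - 1) * (n%:R - 2) * (n%:R - 3) :> R.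
  rewrite -natrM bin_ffact !ffactnS ffactn0 muln1 !natrM.
  case: n n4 => [|[|[|[|m]]]] // _.
  by rewrite /= -!natr1; ring.
by rewrite mulrA -invfM cE mulrA -invfM [_ * 4]mulrC.
Qed.

End Sorted_tuples.

(** * Squared differences, and Cauchy-Schwarz for U-centered matrices *)

Section Squared_distances.
Context (R : realType) (n : nat).
Implicit Types x y : 'I_n -> R.

(** Every summand met below is, in its summation index, a combination of the nine monomials x^i y^j
    with i, j <= 2. Supplying the coefficients by hand reduces each sum to power sums and leaves
    only [ring] goals. *)
Lemma sum_quadratic x y (f : 'I_n -> R) (k0 k1 k2 k3 k4 k5 k6 k7 k8 : R) :
  (forall s, f s = k0 + k1 * x s + k2 * y s + k3 * x s ^+ 2 + k4 * (x s * y s)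
     + k5 * y s ^+ 2 + k6 * (x s ^+ 2 * y s) + k7 * (x s * y s ^+ 2)
     + k8 * (x s ^+ 2 * y s ^+ 2)) ->
  \sum_s f s = n%:R * k0 + k1 * (\sum_s x s) + k2 * (\sum_s y s)
    + k3 * (\sum_s x s ^+ 2) + k4 * (\sum_s x s * y s) + k5 * (\sum_s y s ^+ 2)
    + k6 * (\sum_s x s ^+ 2 * y s) + k7 * (\sum_s x s * y s ^+ 2)
    + k8 * (\sum_s x s ^+ 2 * y s ^+ 2).
Proof.
move=> fE; rewrite (eq_bigr _ (fun s _ => fE s)) !big_split /= -!mulr_sumr.
by rewrite sumr_const card_ord -[k0 *+ n]mulr_natl.
Qed.

Definition sqdiff_mx x : 'M[R]_n := \matrix_(s, t) (x s - x t) ^+ 2.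

(** Through [UinnerE] and [cov2E] both sides become expressions in n and the eight power sums [X1],
    ..., [P22], and the identity is then one of rational functions, whose denominators are nonzero
    since n >= 4. *)
Lemma Uinner_sqdiff x y : (4 <= n)%N ->
  Uinner (Ucenter (sqdiff_mx x)) (Ucenter (sqdiff_mx y)) = 4 * cov2 x y.
Proof.
move=> n4; rewrite cov2E // UinnerE //; last first.
- by move=> s; rewrite mxE; ring.
- by move=> s; rewrite mxE; ring.
- by move=> s t; rewrite !mxE; ring.
- by move=> s t; rewrite !mxE; ring.
rewrite /Uform.
pose h s t := (x s - x t) * (y s - y t).
pose X1 := \sum_s x s; pose Y1 := \sum_s y s.
pose X2 := \sum_s x s ^+ 2; pose Y2 := \sum_s y s ^+ 2.
pose P11 := \sum_s x s * y s; pose P21 := \sum_s x s ^+ 2 * y s.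
pose P12 := \sum_s x s * y s ^+ 2; pose P22 := \sum_s x s ^+ 2 * y s ^+ 2.
have rowX s : \sum_t sqdiff_mx x s t = n%:R * x s ^+ 2 - 2 * X1 * x s + X2.
  rewrite (@sum_quadratic x y _ (x s ^+ 2) (-2 * x s) 0 1 0 0 0 0 0) => [|t];
    by rewrite ?mxE /X1 /X2; ring.
have rowY s : \sum_t sqdiff_mx y s t = n%:R * y s ^+ 2 - 2 * Y1 * y s + Y2.
  rewrite (@sum_quadratic x y _ (y s ^+ 2) 0 (-2 * y s) 0 0 1 0 0 0) => [|t];
    by rewrite ?mxE /Y1 /Y2; ring.
have rowH s : \sum_t h s t = n%:R * (x s * y s) - Y1 * x s - X1 * y s + P11.
  rewrite (@sum_quadratic x y _ (x s * y s) (- y s) (- x s) 0 1 0 0 0 0) => [|t];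
    by rewrite /h /X1 /Y1 /P11; ring.
have rowH2 s : \sum_t h s t ^+ 2 = n%:R * (x s ^+ 2 * y s ^+ 2)
    - 2 * X1 * (x s * y s ^+ 2) - 2 * Y1 * (x s ^+ 2 * y s) + X2 * y s ^+ 2
    + 4 * P11 * (x s * y s) + Y2 * x s ^+ 2 - 2 * P21 * y s - 2 * P12 * x s + P22.
  rewrite (@sum_quadratic x y _ (x s ^+ 2 * y s ^+ 2) (-2 * (x s * y s ^+ 2))
     (-2 * (x s ^+ 2 * y s)) (y s ^+ 2) (4 * (x s * y s)) (x s ^+ 2)
     (-2 * y s) (-2 * x s) 1) => [|t];
    by rewrite /h /X1 /Y1 /X2 /Y2 /P11 /P12 /P21 /P22; ring.
have -> : \sum_s \sum_t sqdiff_mx x s t * sqdiff_mx y s t = \sum_s \sum_t h s t ^+ 2.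
  by apply: eq_bigr => s _; apply: eq_bigr => t _; rewrite !mxE /h; ring.
have -> : \sum_s \sum_t sqdiff_mx x s t = 2 * n%:R * X2 - 2 * X1 ^+ 2.
  rewrite (@sum_quadratic x y _ X2 (-2 * X1) 0 n%:R 0 0 0 0 0) => [|t];
    by rewrite ?rowX /X1 /X2; ring.
have -> : \sum_s \sum_t sqdiff_mx y s t = 2 * n%:R * Y2 - 2 * Y1 ^+ 2.
  rewrite (@sum_quadratic x y _ Y2 0 (-2 * Y1) 0 0 n%:R 0 0 0) => [|t];
    by rewrite ?rowY /Y1 /Y2; ring.
have -> : \sum_s \sum_t h s t = 2 * n%:R * P11 - 2 * (X1 * Y1).
  rewrite (@sum_quadratic x y _ P11 (- Y1) (- X1) 0 n%:R 0 0 0 0) => [|t];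
    by rewrite ?rowH /X1 /Y1 /P11; ring.
have -> : \sum_s (\sum_t sqdiff_mx x s t) * (\sum_t sqdiff_mx y s t) =
    n%:R ^+ 2 * P22 - 2 * n%:R * Y1 * P21 - 2 * n%:R * X1 * P12 + 3 * n%:R * (X2 * Y2)
    + 4 * (X1 * Y1) * P11 - 2 * X1 ^+ 2 * Y2 - 2 * Y1 ^+ 2 * X2.
  rewrite (@sum_quadratic x y _ (X2 * Y2) (- 2 * X1 * Y2) (- 2 * Y1 * X2)
    (n%:R * Y2) (4 * X1 * Y1) (n%:R * X2) (- 2 * n%:R * Y1) (- 2 * n%:R * X1)
    (n%:R ^+ 2)) => [|s]; last by rewrite rowX rowY; ring.
  by rewrite -/X1 -/Y1 -/X2 -/Y2 -/P11 -/P12 -/P21 -/P22; ring.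
have -> : \sum_s (\sum_t h s t) ^+ 2 =
    n%:R ^+ 2 * P22 - 2 * n%:R * Y1 * P21 - 2 * n%:R * X1 * P12 + 3 * n%:R * P11 ^+ 2
    + Y1 ^+ 2 * X2 + X1 ^+ 2 * Y2 - 2 * (X1 * Y1) * P11.
  rewrite (@sum_quadratic x y _ (P11 ^+ 2) (- 2 * Y1 * P11) (- 2 * X1 * P11)
    (Y1 ^+ 2) (2 * X1 * Y1 + 2 * n%:R * P11) (X1 ^+ 2) (- 2 * n%:R * Y1)
    (- 2 * n%:R * X1) (n%:R ^+ 2)) => [|s]; last by rewrite rowH; ring.
  by rewrite -/X1 -/Y1 -/X2 -/Y2 -/P11 -/P12 -/P21 -/P22; ring.
have -> : \sum_s \sum_t h s t ^+ 2 =
    2 * n%:R * P22 - 4 * X1 * P12 - 4 * Y1 * P21 + 2 * X2 * Y2 + 4 * P11 ^+ 2.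
  rewrite (@sum_quadratic x y _ P22 (- 2 * P12) (- 2 * P21) Y2 (4 * P11) X2
    (- 2 * Y1) (- 2 * X1) n%:R) => [|s]; last by rewrite rowH2; ring.
  by rewrite -/X1 -/Y1 -/X2 -/Y2 -/P11 -/P12 -/P21 -/P22; ring.
move: (natn_gt R n4 (k := 0)) (natn_gt R n4 (k := 1)) (natn_gt R n4 (k := 2))
  (natn_gt R n4 (k := 3)) => /(_ isT) n0 /(_ isT) n1 /(_ isT) n2 /(_ isT) n3.
by field; rewrite !gt_eqF ?subr_gt0.
Qed.

(** Cauchy-Schwarz by Lagrange's identity: twice the gap is a double sum of squares. *)
Lemma sum_mul_sqr_le (I : finType) (f g : I -> R) :
  (\sum_i f i * g i) ^+ 2 <= (\sum_i f i ^+ 2) * (\sum_i g i ^+ 2).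
Proof.
set F := \sum_i f i ^+ 2; set G := \sum_i g i ^+ 2; set Y := \sum_i f i * g i.
have : 0 <= \sum_i \sum_j (f i * g j - f j * g i) ^+ 2.
  by apply: sumr_ge0 => i _; apply: sumr_ge0 => j _; rewrite sqr_ge0.
have -> : \sum_i \sum_j (f i * g j - f j * g i) ^+ 2 = 2 * (F * G) - 2 * Y ^+ 2.
  transitivity (\sum_i (f i ^+ 2 * G - 2 * (Y * (f i * g i)) + F * g i ^+ 2)).
    apply: eq_bigr => i _; rewrite /F /G /Y mulr_suml !mulr_sumr -sumrN mulr_suml.
    by rewrite -!big_split; apply: eq_bigr => j _ /=; ring.
  rewrite !(big_split, sumrN) /= -mulr_suml -!mulr_sumr -/F -/G -/Y; ring.
lra.
Qed.

(** With S the total and D the sum of the squared row sums, [Uform A A] adds S^2 / ((n - 1) (n - 2))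
    - 2 D / (n - 2) to the sum of squares. Cauchy-Schwarz gives S^2 <= n D, and n <= 2 (n - 1) makes
    this correction nonpositive. *)
Lemma Ucenter_sqr_le (A : 'M[R]_n) : (4 <= n)%N ->
  (forall s t, A s t = A t s) -> (forall s, A s s = 0) ->
  \sum_s \sum_(t | s != t) Ucenter A s t ^+ 2 <= \sum_s \sum_t A s t ^+ 2.
Proof.
move=> n4 symA A0.
have -> : \sum_s \sum_(t | s != t) Ucenter A s t ^+ 2 = Uform A A.
  by rewrite -sum_Ucenter_mul //; under eq_bigr do under eq_bigr do rewrite expr2.
have -> : \sum_s \sum_t A s t ^+ 2 = \sum_s \sum_t A s t * A s t.
  by under eq_bigr do under eq_bigr do rewrite expr2.
rewrite /Uform -!expr2.
set S := \sum_s \sum_t A s t; set D := \sum_s _ * _.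
have SD : S ^+ 2 <= n%:R * D.
  have := sum_mul_sqr_le (fun s => \sum_t A s t) (fun=> 1).
  under eq_bigr do rewrite mulr1.
  under [X in _ <= _ * X]eq_bigr do rewrite expr1n.
  rewrite sumr_const card_ord mulrC /S /D.
  by under [X in _ <= _ * X -> _]eq_bigr do rewrite expr2.
move: (natn_gt R n4 (k := 1)) (natn_gt R n4 (k := 2)) => /(_ isT) n1 /(_ isT) n2.
have D0 : 0 <= D by apply: sumr_ge0 => s _; rewrite -expr2 sqr_ge0.
rewrite -addrA gerDl subr_le0 invfM [_^-1 * _^-1]mulrC (mulrC 2) -!mulrA.
rewrite ler_pM2l ?invr_gt0; last lra.
rewrite ler_pdivrMl; last lra.
apply: le_trans SD _; rewrite mulrA ler_wpM2r //; lra.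
Qed.

Lemma norm_Uinner_le (A B : 'M[R]_n) (CA CB : R) : (4 <= n)%N ->
  (forall s t, A s t = A t s) -> (forall s, A s s = 0) ->
  (forall s t, B s t = B t s) -> (forall s, B s s = 0) ->
  0 <= CA -> 0 <= CB ->
  \sum_s \sum_t A s t ^+ 2 <= CA ^+ 2 -> \sum_s \sum_t B s t ^+ 2 <= CB ^+ 2 ->
  `|Uinner (Ucenter A) (Ucenter B)| <= (n%:R * (n%:R - 3))^-1 * (CA * CB).
Proof.
move=> n4 symA A0 symB B0 CA0 CB0 SA SB.
move: (natn_gt R n4 (k := 0)) (natn_gt R n4 (k := 3)) => /(_ isT) n0 /(_ isT) n3.
have np : 0 < (n%:R * (n%:R - 3))^-1 :> R by rewrite invr_gt0 mulr_gt0 // subr_gt0.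
rewrite /Uinner normrM (gtr0_norm np) ler_pM2l //.
rewrite -ler_sqr ?nnegrE ?normr_ge0 ?mulr_ge0 // real_normK ?num_real //.
(* Extension by zero turns the off-diagonal double sum into a sum over one finite type, the form
   required by [sum_mul_sqr_le]. *)
pose od (C : 'M[R]_n) (i : 'I_n * 'I_n) := if i.1 != i.2 then C i.1 i.2 else 0.
have odE (C D : 'M[R]_n) :
    \sum_s \sum_(t | s != t) C s t * D s t = \sum_i od C i * od D i.
  under eq_bigr do rewrite big_mkcond.
  rewrite pair_big /=; apply: eq_bigr => i _; rewrite /od.
  by case: ifP => // _; rewrite mulr0.
have sqE (C : 'M[R]_n) : \sum_i od C i ^+ 2 = \sum_s \sum_(t | s != t) C s t ^+ 2.
  under eq_bigr do rewrite expr2.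
  by rewrite -odE; under eq_bigr do under eq_bigr do rewrite -expr2.
rewrite odE; apply: le_trans (sum_mul_sqr_le _ _) _.
rewrite !sqE exprMn ler_pM ?sumr_ge0 //.
- by move=> s _; apply: sumr_ge0 => t _; rewrite sqr_ge0.
- by move=> s _; apply: sumr_ge0 => t _; rewrite sqr_ge0.
- exact: le_trans (Ucenter_sqr_le _ _ _) SA.
- exact: le_trans (Ucenter_sqr_le _ _ _) SB.
Qed.

End Squared_distances.

(** * Expansion of the distances *)

Section Expansion.
Context (R : realType) (n m : nat).
Implicit Types (x : 'I_n -> m.-tuple R) (c : R).

(** [c] will be tau_X^2 or tau_Y^2. On the diagonal the formula itself would give -1 for nonzero
    [c], hence [offdiag]. *)
Definition rel_mx c x : 'M[R]_n :=
  offdiag (fun s t => (eucl_dist (x s) (x t) ^+ 2 - c) / c).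

Definition rem_mx c x : 'M[R]_n :=
  offdiag (fun s t => eucl_dist (x s) (x t) / Num.sqrt c - 1
                      - 2^-1 * ((eucl_dist (x s) (x t) ^+ 2 - c) / c)).

Lemma sqr_eucl_dist (u v : m.-tuple R) :
  eucl_dist u v ^+ 2 = \sum_(i < m) (tnth u i - tnth v i) ^+ 2.
Proof. by rewrite sqr_sqrtr // sumr_ge0 // => i _; rewrite sqr_ge0. Qed.

Lemma eucl_distC (u v : m.-tuple R) : eucl_dist u v = eucl_dist v u.
Proof. by congr Num.sqrt; apply: eq_bigr => i _; ring. Qed.

Lemma eucl_distxx (u : m.-tuple R) : eucl_dist u u = 0.
Proof. by rewrite /eucl_dist big1 ?sqrtr0 // => i _; rewrite subrr expr0n. Qed.

Lemma rel_mxC c x s t : rel_mx c x s t = rel_mx c x t s.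
Proof. by rewrite !mxE eq_sym eucl_distC. Qed.

Lemma rel_mxxx c x s : rel_mx c x s s = 0.
Proof. by rewrite mxE eqxx. Qed.

Lemma rem_mxC c x s t : rem_mx c x s t = rem_mx c x t s.
Proof. by rewrite !mxE eq_sym eucl_distC. Qed.

Lemma rem_mxxx c x s : rem_mx c x s s = 0.
Proof. by rewrite mxE eqxx. Qed.

(* With d = |u - v| / sqrt c, the relative error is d^2 - 1 and the remainder
   is - (d - 1)^2 / 2. *)
Lemma sqr_rem_mx_le c x s t : 0 < c -> rem_mx c x s t ^+ 2 <= rel_mx c x s t ^+ 4.
Proof.
move=> c0; rewrite !mxE; case: eqP => _; first by rewrite !expr0n.
have s0 : 0 < Num.sqrt c by rewrite sqrtr_gt0.
have -> : (eucl_dist (x s) (x t) ^+ 2 - c) / c = (eucl_dist (x s) (x t) / Num.sqrt c) ^+ 2 - 1.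
  by rewrite exprMn exprVn (sqr_sqrtr (ltW c0)) mulrBl divff ?gt_eqF.
set r := _ / Num.sqrt c.
have r0 : 0 <= r by rewrite mulr_ge0 ?sqrtr_ge0 // invr_ge0 ltW.
have -> : (r - 1 - 2^-1 * (r ^+ 2 - 1)) ^+ 2 = 4^-1 * (r - 1) ^+ 4 by field.
have -> : (r ^+ 2 - 1) ^+ 4 = (r + 1) ^+ 4 * (r - 1) ^+ 4 by ring.
have e4 : 0 <= (r - 1) ^+ 4 by rewrite (exprM _ 2 2) sqr_ge0.
apply: ler_wpM2r => //.
by apply: (@le_trans _ _ 1); [lra | rewrite exprn_ege1 // lerDr].
Qed.

Lemma Ucenter_dist_mx c x : (4 <= n)%N -> 0 < c ->
  Ucenter (dist_mx x) =
  Num.sqrt c *: (2^-1 *: Ucenter (rel_mx c x) + Ucenter (rem_mx c x)).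
Proof.
move=> n4 c0.
have -> : dist_mx x = Num.sqrt c *: (offdiag (fun _ _ => 1) + 2^-1 *: rel_mx c x + rem_mx c x).
  apply/matrixP => s t; rewrite !mxE; case: eqP => [->|_].
    by rewrite eucl_distxx mulr0 !addr0 mulr0.
  by field; rewrite gt_eqF // gt_eqF // sqrtr_gt0.
rewrite linearZ /=; congr (_ *: _); rewrite 2!linearD /= Ucenter_offdiag_cst // add0r.
by congr (_ + _); rewrite linearZ.
Qed.

(** The squared Euclidean distance is additive over coordinates and equals c (1 + L) off the
    diagonal. This collapses the double sum over coordinates i, j into a single inner product. *)
Lemma sum_Ucenter_sqdiff c x : (4 <= n)%N -> 0 < c ->
  \sum_(i < m) Ucenter (sqdiff_mx (fun s => tnth (x s) i)) = c *: Ucenter (rel_mx c x).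
Proof.
move=> n4 c0; rewrite -linear_sum /=.
have -> : \sum_(i < m) sqdiff_mx (fun s => tnth (x s) i) =
    c *: (offdiag (fun _ _ => 1) + rel_mx c x).
  apply/matrixP => s t; rewrite summxE.
  transitivity (eucl_dist (x s) (x t) ^+ 2).
    by rewrite sqr_eucl_dist; apply: eq_bigr => i _; rewrite mxE.
  rewrite !mxE; case: eqP => [->|_]; first by rewrite eucl_distxx expr0n addr0 mulr0.
  by field; rewrite gt_eqF.
by rewrite linearZ /= linearD /= Ucenter_offdiag_cst // add0r.
Qed.

End Expansion.

(** * Deterministic bounds for one realisation of the sample *)

Section Bounds.
Context (R : realType) (n p q : nat) (x : 'I_n -> p.-tuple R) (y : 'I_n -> q.-tuple R).
Context (cx cy : R).
Hypotheses (n4 : (4 <= n)%N) (cx0 : 0 < cx) (cy0 : 0 < cy).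

Local Notation tau := (Num.sqrt cx * Num.sqrt cy).
Local Notation Lx := (rel_mx cx x).
Local Notation Ly := (rel_mx cy y).
Local Notation Rx := (rem_mx cx x).
Local Notation Ry := (rem_mx cy y).

Lemma sum_cov2E :
  tau^-1 * sum_cov2 x y = tau * (4^-1 * Uinner (Ucenter Lx) (Ucenter Ly)).
Proof.
have -> : sum_cov2 x y = 4^-1 * Uinner (cx *: Ucenter Lx) (cy *: Ucenter Ly).
  rewrite -!sum_Ucenter_sqdiff // Uinner_suml mulr_sumr; apply: eq_bigr => i _.
  rewrite Uinner_sumr mulr_sumr; apply: eq_bigr => j _.
  by rewrite Uinner_sqdiff // mulKf.
have sx : 0 < Num.sqrt cx by rewrite sqrtr_gt0.
have sy : 0 < Num.sqrt cy by rewrite sqrtr_gt0.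
rewrite UinnerZl UinnerZr; set U := Uinner _ _.
have -> : cx * (cy * U) = Num.sqrt cx ^+ 2 * (Num.sqrt cy ^+ 2 * U).
  by rewrite (sqr_sqrtr (ltW cx0)) (sqr_sqrtr (ltW cy0)).
by field; rewrite !gt_eqF.
Qed.

(** Among the four products in the expansion of (L_X / 2 + R_X) against (L_Y / 2 + R_Y), the one
    with coefficient 1/4 is the covariance term and cancels. *)
Lemma dCov2_remainder :
  dCov2 x y - tau^-1 * sum_cov2 x y =
  tau * (2^-1 * Uinner (Ucenter Lx) (Ucenter Ry) + 2^-1 * Uinner (Ucenter Rx) (Ucenter Ly)
         + Uinner (Ucenter Rx) (Ucenter Ry)).
Proof.
rewrite sum_cov2E /dCov2 (Ucenter_dist_mx _ n4 cx0) (Ucenter_dist_mx _ n4 cy0).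
by rewrite UinnerZl UinnerZr UinnerDl !UinnerDr !UinnerZl !UinnerZr; field.
Qed.

(** The bounds below are those of the good event: with n (n - 1) off-diagonal entries of mean
    [al ^+ 2], the first sum has expectation n (n - 1) [al ^+ 2], and likewise for the other
    three. *)
Context (al be ga la K : R).
Hypotheses (al0 : 0 <= al) (be0 : 0 <= be) (ga0 : 0 <= ga) (la0 : 0 <= la) (K0 : 0 <= K).
Hypothesis Lx2 : \sum_s \sum_t Lx s t ^+ 2 <= K * (n%:R * (n%:R - 1) * al ^+ 2).
Hypothesis Ly2 : \sum_s \sum_t Ly s t ^+ 2 <= K * (n%:R * (n%:R - 1) * be ^+ 2).
Hypothesis Lx4 : \sum_s \sum_t Lx s t ^+ 4 <= K * (n%:R * (n%:R - 1) * ga ^+ 2).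
Hypothesis Ly4 : \sum_s \sum_t Ly s t ^+ 4 <= K * (n%:R * (n%:R - 1) * la ^+ 2).

(* The factor 3 bounds (n - 1) / (n - 3). *)
Lemma norm_Uinner_le3 (A B : 'M[R]_n) (a b : R) : 0 <= a -> 0 <= b ->
  (forall s t, A s t = A t s) -> (forall s, A s s = 0) ->
  (forall s t, B s t = B t s) -> (forall s, B s s = 0) ->
  \sum_s \sum_t A s t ^+ 2 <= K * (n%:R * (n%:R - 1) * a ^+ 2) ->
  \sum_s \sum_t B s t ^+ 2 <= K * (n%:R * (n%:R - 1) * b ^+ 2) ->
  `|Uinner (Ucenter A) (Ucenter B)| <= 3 * K * (a * b).
Proof.
move=> a0 b0 symA A0 symB B0 SA SB.
have n0 := natn_gt R n4 (isT : 0 < 4)%N; have n1 := natn_gt R n4 (isT : 1 < 4)%N.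
have n3 := natn_gt R n4 (isT : 3 < 4)%N.
have n4R : 4 <= n%:R :> R by rewrite ler_nat.
set N := n%:R * (n%:R - 1) in SA SB.
have N0 : 0 <= N by rewrite mulr_ge0 // subr_ge0 ltW.
have KN0 : 0 <= K * N by rewrite mulr_ge0.
have sqE (z : R) : (Num.sqrt (K * N) * z) ^+ 2 = K * (N * z ^+ 2).
  by rewrite exprMn (sqr_sqrtr KN0) -mulrA.
have := @norm_Uinner_le _ _ A B (Num.sqrt (K * N) * a) (Num.sqrt (K * N) * b) n4 symA A0 symB B0.
rewrite !sqE !mulr_ge0 ?sqrtr_ge0 // => /(_ isT isT SA SB)/le_trans; apply.
have -> : Num.sqrt (K * N) * a * (Num.sqrt (K * N) * b) = K * N * (a * b).
  by rewrite -[in RHS](sqr_sqrtr KN0); ring.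
rewrite ler_pdivrMl ?mulr_gt0 ?subr_gt0 // -subr_ge0.
have -> : n%:R * (n%:R - 3) * (3 * K * (a * b)) - K * N * (a * b) =
   K * (a * b) * (2 * (n%:R * (n%:R - 4))).
  by rewrite /N; ring.
by rewrite !mulr_ge0 ?subr_ge0 // ltW.
Qed.

Lemma sum_sqr_rem_mx_le (k : nat) (z : 'I_n -> k.-tuple R) (c B : R) : 0 < c ->
  \sum_s \sum_t rel_mx c z s t ^+ 4 <= B -> \sum_s \sum_t rem_mx c z s t ^+ 2 <= B.
Proof.
move=> c0; apply: le_trans; apply: ler_sum => s _; apply: ler_sum => t _.
exact: sqr_rem_mx_le.
Qed.

Lemma norm_lead_le : `|tau^-1 * sum_cov2 x y| <= 3 * K * (tau * al * be).
Proof.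
rewrite sum_cov2E normrM ger0_norm ?mulr_ge0 ?sqrtr_ge0 //.
have -> : 3 * K * (tau * al * be) = tau * (3 * K * (al * be)) by ring.
apply: ler_wpM2l; first by rewrite mulr_ge0 ?sqrtr_ge0.
rewrite (normrM 4^-1) (ger0_norm (_ : 0 <= 4^-1)) //.
have := norm_Uinner_le3 al0 be0
  (rel_mxC cx x) (rel_mxxx cx x) (rel_mxC cy y) (rel_mxxx cy y) Lx2 Ly2.
by have := normr_ge0 (Uinner (Ucenter Lx) (Ucenter Ly)); lra.
Qed.

Lemma norm_remainder_le :
  `|dCov2 x y - tau^-1 * sum_cov2 x y| <=
  3 * K * (tau * al * la + tau * ga * be + tau * ga * la).
Proof.
rewrite dCov2_remainder normrM ger0_norm ?mulr_ge0 ?sqrtr_ge0 //.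
have -> : 3 * K * (tau * al * la + tau * ga * be + tau * ga * la) =
  tau * (3 * K * (al * la) + 3 * K * (ga * be) + 3 * K * (ga * la)) by ring.
apply: ler_wpM2l; first by rewrite mulr_ge0 ?sqrtr_ge0.
(* Since R^2 <= L^4 entrywise, the remainder matrices obey the same kind of bound, with [ga] and
   [la] in place of [al] and [be]. *)
have Rx2 := sum_sqr_rem_mx_le cx0 Lx4; have Ry2 := sum_sqr_rem_mx_le cy0 Ly4.
have H1 := norm_Uinner_le3 al0 la0
  (rel_mxC cx x) (rel_mxxx cx x) (rem_mxC cy y) (rem_mxxx cy y) Lx2 Ry2.
have H2 := norm_Uinner_le3 ga0 be0
  (rem_mxC cx x) (rem_mxxx cx x) (rel_mxC cy y) (rel_mxxx cy y) Rx2 Ly2.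
have H3 := norm_Uinner_le3 ga0 la0
  (rem_mxC cx x) (rem_mxxx cx x) (rem_mxC cy y) (rem_mxxx cy y) Rx2 Ry2.
apply: le_trans (ler_normD _ _) _; apply: lerD => //.
apply: le_trans (ler_normD _ _) _; rewrite !(normrM 2^-1) (ger0_norm (_ : 0 <= 2^-1)) //.
have := normr_ge0 (Uinner (Ucenter Lx) (Ucenter Ry)).
have := normr_ge0 (Uinner (Ucenter Rx) (Ucenter Ly)).
lra.
Qed.

End Bounds.

(** * Moments and laws of pairs *)

Lemma measurable_eucl_dist (R : realType) d (T : measurableType d) (m : nat)
    (U V : T -> m.-tuple R) :
  measurable_fun setT U -> measurable_fun setT V ->
  measurable_fun setT (fun w => eucl_dist (U w) (V w)).
Proof.
move=> mU mV; apply: (@measurableT_comp _ _ _ _ _ _ (@Num.sqrt R)).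
  by apply: continuous_measurable_fun; exact: sqrt_continuous.
apply: measurable_sum => i; apply: measurable_funX; apply: measurable_funB.
  by apply: (@measurableT_comp _ _ _ _ _ _ (fun x => tnth x i)) => //; exact: measurable_tnth.
by apply: (@measurableT_comp _ _ _ _ _ _ (fun x => tnth x i)) => //; exact: measurable_tnth.
Qed.

Lemma measurable_gt_set (R : realType) d (T : measurableType d) (c : R) (f : T -> R) :
  measurable_fun setT f -> measurable [set w | c < f w].
Proof.
move=> mf; rewrite -[X in measurable X]setTI.
have := measurable_fun_ltr (measurable_cst c) mf.
by move=> /(_ measurableT [set true] I); congr measurable; apply/seteqP; split => w /=.
Qed.

(* Strict inequality in the event makes the bound true for c = 0 as well, as
   needed when a rate in O_p vanishes. *)
Lemma markov_tail_le (R : realType) d (T : measurableType d) (P : probability T R)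
    (S : T -> R) (c K : R) :
  measurable_fun setT S -> (forall w, 0 <= S w) -> 0 <= c -> 0 < K ->
  (\int[P]_w (S w)%:E <= c%:E)%E -> (P [set w | (K * c < S w)%R] <= K^-1%:E)%E.
Proof.
move=> mS S0 c0 K0 Sc.
have mES : measurable_fun setT (EFin \o S) by apply/measurable_EFinP.
have absE : (\int[P]_w `|(EFin \o S) w| = \int[P]_w (S w)%:E)%E.
  by apply: eq_integral => w _ /=; rewrite ger0_norm.
move: c0; rewrite le_eqVlt => /orP[/eqP c0|c0].
  suff : P [set w | K * c < S w] = 0%E by move=> ->; rewrite lee_fin invr_ge0 ltW.
  have : (\int[P]_w `|(EFin \o S) w| = 0)%E.
    by apply/eqP; rewrite eq_le integral_ge0 ?andbT // absE (le_trans Sc) // -c0.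
  move/(ae_eq_integral_abs P measurableT mES) => [N [mN PN sub]].
  apply: (subset_measure0 _ mN _ PN); first exact: measurable_gt_set.
  move=> w /= Sw; apply: sub => /= /(_ I) [] Sw0.
  by move: Sw; rewrite Sw0 -c0 mulr0 ltxx.
have Kc : 0 < K * c by rewrite mulr_gt0.
have := le_integral_abse P measurableT mES Kc; rewrite absE setTI => Q.
have mge : measurable [set x | ((K * c)%:E <= `|(EFin \o S) x|)%E].
  rewrite -[X in measurable X]setTI.
  by apply: emeasurable_fun_c_infty => //; exact: measurableT_comp.
have le1 : (P [set w | (K * c < S w)%R] <= P [set x | (K * c)%:E <= `|(EFin \o S) x|])%E.
  apply: le_measure; rewrite ?inE //; first exact: measurable_gt_set.
  by move=> w /= Sw; rewrite lee_fin (le_trans (ltW Sw)) ?ler_norm.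
apply: le_trans le1 _; move: (le_trans Q Sc).
rewrite -lee_pdivlMl // => /le_trans; apply.
by rewrite -EFinM lee_fin invfM -mulrA mulVf ?mulr1 // gt_eqF.
Qed.

Section Law_of_pair.
Context (R : realType) d d' (T : measurableType d) (V : measurableType d').

(** The law of the pair is the product measure, by uniqueness on rectangles. [mu] is a separate
    parameter so that the sample and the pair (Z, Z'), living on different probability spaces, can
    be compared through the same product. *)
Lemma ge0_integral_indep_pair (P : probability T R) (mu : probability V R)
    (Z1 Z2 : {RV P >-> V}) (f : V * V -> \bar R) :
  (forall A B, measurable A -> measurable B ->
     P ((Z1 @^-1` A) `&` (Z2 @^-1` B)) = (mu A * mu B)%E) ->
  measurable_fun setT f -> (forall v, 0 <= f v)%E ->
  (\int[P]_w f (Z1 w, Z2 w) = \int[mu \x mu]_v f v)%E.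
Proof.
move=> ind mf f0.
have mW : measurable_fun setT (fun w => (Z1 w, Z2 w)) by apply: measurable_fun_pair.
pose W : {mfun T >-> (V * V)%type} :=
  HB.pack (fun w => (Z1 w, Z2 w)) (isMeasurableFun.Build _ _ _ _ _ mW).
transitivity (\int[distribution P W]_v f v)%E; first by rewrite ge0_integral_distribution.
apply: eq_measure_integral => A mA _; apply/esym.
by apply: product_measure_unique => // B C mB mC; rewrite -ind.
Qed.

End Law_of_pair.

Section Second_moments.
Context (R : realType) d (T : measurableType d) (P : probability T R) (X : T -> R).
Hypothesis mX : measurable_fun setT X.

Lemma Lfun2_sqr_integral : (\int[P]_w (X w ^+ 2)%:E < +oo)%E -> X \in Lfun P 2%:E.
Proof.
move=> X2; rewrite inE; apply/andP; split; rewrite inE //=.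
rewrite /finite_norm unlock poweR_lty //.
apply: le_lt_trans X2; rewrite le_eqVlt; apply/orP; left; apply/eqP.
by apply: eq_integral => w _ /=; rewrite powR_mulrn // real_normK // num_real.
Qed.

(** [c - X] has the same variance as [X], and a variance is at most the second moment. *)
Lemma variance_le_sqr_dist (c : R) : (\int[P]_w (X w ^+ 2)%:E < +oo)%E ->
  ('V_P[X] <= \int[P]_w ((c - X w) ^+ 2)%:E)%E.
Proof.
move=> /Lfun2_sqr_integral X2.
have cX2 : (cst c \- X)%R \in Lfun P 2%:E.
  by rewrite rpredB ?lee_fin ?ler1n // => ?; exact: Lfun_cst.
rewrite -(varianceB_cst_l c X2) varianceE // -[X in (_ <= X)%E]sube0.
by apply: leeB; [rewrite unlock | exact: sqre_ge0].
Qed.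

End Second_moments.

Section Independent_copy.
Context (R : realType) d0 d' (T0 : measurableType d0) (V : measurableType d').
Context (P0 : probability T0 R) (Z Z' : {RV P0 >-> V}).
Hypothesis hcopy : independent_copy Z Z'.

Local Notation mu := (distribution P0 Z).

Lemma ge0_integral_copy (f : V * V -> \bar R) :
  measurable_fun setT f -> (forall v, 0 <= f v)%E ->
  (\int[P0]_w f (Z w, Z' w) = \int[mu \x mu]_v f v)%E.
Proof.
case: hcopy => ind same mf f0; apply: ge0_integral_indep_pair => // A B mA mB.
rewrite ind //; congr (_ * _)%E; exact: same.
Qed.

Section Second_moment_of_difference.
Context (h : V -> R) (a b : R).
Hypothesis mh : measurable_fun setT h.
Hypothesis a0 : 0 < a.
Hypothesis ha : (a%:E <= 'V_P0[h \o Z])%E.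
Hypothesis hb : ('E_P0[(fun w => h (Z w) ^+ 2)%R] <= b%:E)%E.

Let mhZ : measurable_fun setT (h \o Z).
Proof. exact: measurableT_comp. Qed.

Let mhZ' : measurable_fun setT (h \o Z').
Proof. exact: measurableT_comp. Qed.

(* Given Z, the mean square distance of h (Z') to the constant h (Z) is at least
   the variance. *)
Lemma integral_sqr_diff_ge :
  (a%:E <= \int[P0]_w ((h (Z w) - h (Z' w)) ^+ 2)%:E)%E.
Proof.
pose f (v : V * V) := (((h v.1 - h v.2) ^+ 2)%:E : \bar R)%E.
have f0 v : (0 <= f v)%E by rewrite lee_fin sqr_ge0.
have mf : measurable_fun setT f.
  by apply/measurable_EFinP; apply: measurable_funX; apply: measurable_funB;
    exact: measurableT_comp.
rewrite (ge0_integral_copy mf f0) fubini_tonelli1 //.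
have fin : (\int[P0]_w ((h \o Z) w ^+ 2)%:E < +oo)%E.
  by move: hb; rewrite unlock => /le_lt_trans; apply; rewrite ltry.
have -> : a%:E = (\int[mu]_x a%:E)%E.
  rewrite integral_cst //; apply/esym; rewrite -[RHS]mule1; congr (_ * _)%E.
  exact: (@probability_setT _ _ _ (distribution P0 Z)).
apply: ge0_le_integral => //.
- by move=> v _; rewrite lee_fin ltW.
- exact: measurable_fun_fubini_tonelli_F.
move=> v _; rewrite /fubini_F ge0_integral_distribution //; last first.
  by apply: measurableT_comp => //; exact: pair1_measurable.
exact: le_trans ha (variance_le_sqr_dist mhZ (h v) fin).
Qed.

(** From (u - v)^2 <= 2 (u^2 + v^2), the gap being (u + v)^2; both squares have mean at most [b]
    because [Z'] has the law of [Z]. *)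
Lemma integral_sqr_diff_le :
  (\int[P0]_w ((h (Z w) - h (Z' w)) ^+ 2)%:E <= (4 * b)%:E)%E.
Proof.
have m1 : measurable_fun setT (fun w => (h (Z w) ^+ 2)%:E).
  by apply/measurable_EFinP; exact: measurable_funX.
have m2 : measurable_fun setT (fun w => (h (Z' w) ^+ 2)%:E).
  by apply/measurable_EFinP; exact: measurable_funX.
have h2 : (\int[P0]_w (h (Z' w) ^+ 2)%:E = \int[P0]_w (h (Z w) ^+ 2)%:E)%E.
  have mh2 : measurable_fun setT (fun v => (h v ^+ 2)%:E).
    by apply/measurable_EFinP; exact: measurable_funX.
  have h20 v : (0 <= (h v ^+ 2)%:E)%E by rewrite lee_fin sqr_ge0.
  rewrite -(ge0_integral_distribution Z mh2) // -(ge0_integral_distribution Z' mh2) //.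
  by apply: eq_measure_integral => A mA _; exact: (hcopy.2).
apply: (@le_trans _ _ (\int[P0]_w (2%:E * ((h (Z w) ^+ 2)%:E + (h (Z' w) ^+ 2)%:E)))%E).
  apply: ge0_le_integral => //.
  - by move=> w _; rewrite lee_fin sqr_ge0.
  - by apply/measurable_EFinP; apply: measurable_funX; exact: measurable_funB.
  - by apply: emeasurable_funM => //; exact: emeasurable_funD.
  move=> w _; rewrite -EFinD -EFinM lee_fin.
  by have := sqr_ge0 (h (Z w) + h (Z' w)); nra.
rewrite ge0_integralZl //; last 2 first.
- exact: emeasurable_funD.
- by move=> w _; rewrite -EFinD lee_fin addr_ge0 // sqr_ge0.
rewrite ge0_integralD //; [|by move=> w _; rewrite lee_fin sqr_ge0..].
rewrite h2; move: hb; rewrite unlock => hb'.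
have -> : (4 * b)%:E = (2%:E * (b%:E + b%:E))%E by rewrite -EFinD -EFinM; congr EFin; ring.
by rewrite lee_pmul2l // leeD.
Qed.

End Second_moment_of_difference.

Section Vectors.
Context (m : nat) (g : V -> m.-tuple R) (a b : R).
Hypothesis mg : measurable_fun setT g.
Hypothesis a0 : 0 < a.
Hypothesis ha : forall i, (a%:E <= 'V_P0[(fun w => tnth (g (Z w)) i)%R])%E.
Hypothesis hb : forall i, ('E_P0[(fun w => tnth (g (Z w)) i ^+ 2)%R] <= b%:E)%E.

(** The expectation splits over coordinates. One coordinate bounds it below by [a], and all of them
    bound it above by 4 m b, so that [fine] does not collapse it to 0. *)
Lemma tau2_gt0 : (0 < m)%N -> 0 < tau2 P0 (g \o Z) (g \o Z').
Proof.
move=> m0; rewrite /tau2 unlock.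
have mtn i : measurable_fun setT (fun v => tnth (g v) i).
  by apply: (@measurableT_comp _ _ _ _ _ _ (fun x => tnth x i)) => //; exact: measurable_tnth.
have -> : (\int[P0]_w (eucl_dist ((g \o Z) w) ((g \o Z') w) ^+ 2)%:E =
    \sum_(i < m) \int[P0]_w ((tnth (g (Z w)) i - tnth (g (Z' w)) i) ^+ 2)%:E)%E.
  rewrite -ge0_integral_sum //.
  - by apply: eq_integral => w _; rewrite sqr_eucl_dist sumEFin.
  - move=> i; apply/measurable_EFinP; apply: measurable_funX.
    apply: measurable_funB.
      by apply: (@measurableT_comp _ _ _ _ _ _ (fun v => tnth (g v) i)).
    by apply: (@measurableT_comp _ _ _ _ _ _ (fun v => tnth (g v) i)).
  - by move=> i w _; rewrite lee_fin sqr_ge0.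
have lo i := integral_sqr_diff_ge (mtn i) a0 (ha i) (hb i).
have hi i := integral_sqr_diff_le (mtn i) (hb i).
apply: fine_gt0; apply/andP; split.
  apply: (@lt_le_trans _ _ (\int[P0]_w
      ((tnth (g (Z w)) (Ordinal m0) - tnth (g (Z' w)) (Ordinal m0)) ^+ 2)%:E)%E).
    by apply: lt_le_trans (lo _); rewrite lte_fin.
  rewrite (bigD1 (Ordinal m0)) //= leeDl // sume_ge0 // => i _.
  by apply: le_trans (lo _); rewrite lee_fin ltW.
apply: (@le_lt_trans _ _ (\sum_(i < m) (4 * b)%:E)%E); first exact: lee_sum.
by rewrite sumEFin ltry.
Qed.

End Vectors.

Section Sample.
Context d (T : measurableType d) (P : probability T R) (n : nat).
Context (Zs : 'I_n -> {RV P >-> V}).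
Hypothesis hiid : iid_copies Zs Z.

(** Two distinct observations and the pair (Z, Z') have the same joint law, the product of the law
    of [Z] with itself. *)
Lemma ge0_integral_sample (f : V * V -> \bar R) (s t : 'I_n) : s != t ->
  measurable_fun setT f -> (forall v, 0 <= f v)%E ->
  (\int[P]_w f (Zs s w, Zs t w) = \int[P0]_w f (Z w, Z' w))%E.
Proof.
case: hiid => ind same st mf f0; rewrite ge0_integral_copy //.
apply: ge0_integral_indep_pair => // A B mA mB.
(* Mutual independence is stated for the whole family; the full space at the other indices
   contributes factors 1. *)
pose C r := if r == s then A else if r == t then B else setT.
have := ind C; rewrite (bigD1 s) //= (bigD1 t) 1?eq_sym //= big1 => [|r /andP[rs rt]]; last first.
  by rewrite /C (negbTE rs) (negbTE rt) preimage_setT probability_setT.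
have Cs : C s = A by rewrite /C eqxx.
have Ct : C t = B by rewrite /C eq_sym (negbTE st) eqxx.
rewrite mule1 Cs Ct.
have -> : [set w | forall r, C r (Zs r w)] = Zs s @^-1` A `&` Zs t @^-1` B.
  apply/seteqP; split => w /=.
    by move=> H; split; [have := H s; rewrite Cs | have := H t; rewrite Ct].
  move=> [HA HB] r; rewrite /C; case: eqP => [->//|_]; by case: eqP => [->|].
move=> ->; last by move=> r; rewrite /C; case: eqP => // _; case: eqP.
by congr (_ * _)%E; [exact: (same s)|exact: (same t)].
Qed.

Context (m : nat) (g : V -> m.-tuple R).
Hypothesis mg : measurable_fun setT g.

(** Markov's inequality for a sum of mean n (n - 1) e: each off-diagonal entry has mean [e], and the
    diagonal vanishes because [k] is positive. Evenness of [k] makes the summands nonnegative. *)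
Lemma rel_mx_tail_le (k : nat) (e K : R) : ~~ odd k -> (0 < k)%N -> 0 < K ->
  let c := tau2 P0 (g \o Z) (g \o Z') in
  ('E_P0[(fun w => relL P0 (g \o Z) (g \o Z') w ^+ k)%R] = e%:E)%E ->
  (P [set w | (K * (n%:R * (n%:R - 1) * e) <
     \sum_s \sum_t rel_mx c (fun r => g (Zs r w)) s t ^+ k)%R] <= K^-1%:E)%E.
Proof.
move=> evk k0 K0 c; rewrite unlock => eE.
pose f (v : V * V) := ((((eucl_dist (g v.1) (g v.2) ^+ 2 - c) / c) ^+ k)%:E : \bar R)%E.
have f0 v : (0 <= f v)%E by rewrite lee_fin exprn_even_ge0.
have mf : measurable_fun setT f.
  apply/measurable_EFinP; apply: measurable_funX; apply: measurable_funM => //.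
  apply: measurable_funB => //; apply: measurable_funX.
  by apply: measurable_eucl_dist; exact: measurableT_comp.
have e0 : 0 <= e.
  by rewrite -lee_fin -eE integral_ge0 // => w _; rewrite lee_fin exprn_even_ge0.
have mrel s t : measurable_fun setT (fun w => rel_mx c (fun r => g (Zs r w)) s t ^+ k).
  apply: measurable_funX; under eq_fun do rewrite mxE.
  case: eqP => _; first exact: measurable_cst.
  apply: measurable_funM => //; apply: measurable_funB => //; apply: measurable_funX.
  by apply: measurable_eucl_dist; exact: measurableT_comp.
have rel0 s t w : 0 <= rel_mx c (fun r => g (Zs r w)) s t ^+ k by rewrite exprn_even_ge0.
(* The subtraction is real, so n - 1 is negative at n = 0; the product is then 0. *)
have Nge0 : (0 : R) <= n%:R * (n%:R - 1).
  case: (n) => [|r]; first by rewrite mul0r.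
  by rewrite mulr_ge0 // -natr1 addrK.
apply: markov_tail_le => //.
- by apply: measurable_sum => s; exact: measurable_sum.
- by move=> w; apply: sumr_ge0 => s _; apply: sumr_ge0 => t _.
- by rewrite mulr_ge0.
under eq_integral do (rewrite -sumEFin; under eq_bigr do rewrite -sumEFin).
rewrite ge0_integral_sum //; last 2 first.
- by move=> s; apply: emeasurable_sum => t; apply/measurable_EFinP.
- by move=> s w _; apply: sume_ge0 => t _; rewrite lee_fin.
have rowE s : (\int[P]_w \sum_t (rel_mx c (fun r => g (Zs r w)) s t ^+ k)%:E
    = ((n%:R - 1) * e)%:E)%E.
  rewrite ge0_integral_sum //; last 2 first.
  - by move=> t; apply/measurable_EFinP.
  - by move=> t w _; rewrite lee_fin.
  rewrite (bigD1 s) //= integral0_eq ?add0e; last first.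
    by move=> w _; rewrite rel_mxxx expr0n gtn_eqF.
  rewrite (eq_bigr (fun=> e%:E)) => [|t ts].
    rewrite sumEFin sumr_const cardC1 card_ord; congr EFin.
    by rewrite -[LHS]mulr_natl -subn1 natrB // (leq_trans _ (ltn_ord s)).
  rewrite -eE; transitivity (\int[P]_w f (Zs s w, Zs t w))%E.
    by apply: eq_integral => w _; rewrite mxE eq_sym (negbTE ts).
  by rewrite ge0_integral_sample // eq_sym.
rewrite (eq_bigr _ (fun s _ => rowE s)) sumEFin lee_fin sumr_const card_ord.
by rewrite -[X in X <= _]mulr_natl mulrA.
Qed.

End Sample.

End Independent_copy.

(** * Tail bounds *)

Section Measurability.
Context (R : realType) d (T : measurableType d) (n : nat).

Lemma measurable_tnth_comp m (x : T -> m.-tuple R) i :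
  measurable_fun setT x -> measurable_fun setT (fun w => tnth (x w) i).
Proof.
move=> mx; apply: (@measurableT_comp _ _ _ _ _ _ (fun u => tnth u i)) => //.
exact: measurable_tnth.
Qed.

Lemma measurable_cov2 (x y : T -> 'I_n -> R) :
  (forall s, measurable_fun setT (x^~ s)) -> (forall s, measurable_fun setT (y^~ s)) ->
  measurable_fun setT (fun w => cov2 (x w) (y w)).
Proof.
move=> mx my; rewrite /cov2; apply: measurable_funM => //.
apply: measurable_sum => s; apply: measurable_sum => t; apply: measurable_sum => u.
under eq_fun do rewrite big_mkcond.
apply: measurable_sum => v; case: (_ && _); last exact: measurable_cst.
apply: measurable_funM => //; apply: measurable_sum => sg.
by rewrite /cov_kernel; do !(apply: measurable_funM || apply: measurable_funB) => //.
Qed.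

Context (p q : nat) (x : 'I_n -> T -> p.-tuple R) (y : 'I_n -> T -> q.-tuple R).
Hypothesis mx : forall s, measurable_fun setT (x s).
Hypothesis my : forall s, measurable_fun setT (y s).

Lemma measurable_sum_cov2 : measurable_fun setT (fun w => sum_cov2 (x^~ w) (y^~ w)).
Proof.
apply: measurable_sum => i; apply: measurable_sum => j.
by apply: measurable_cov2 => s; exact: measurable_tnth_comp.
Qed.

Lemma measurable_Ucenter (A : T -> 'M[R]_n) s t :
  (forall u v, measurable_fun setT (fun w => A w u v)) ->
  measurable_fun setT (fun w => Ucenter (A w) s t).
Proof.
move=> mA; under eq_fun do rewrite mxE.
case: eqP => _; first exact: measurable_cst.
apply: measurable_funD.
  apply: measurable_funB; first apply: measurable_funB => //.
    by apply: measurable_funM => //; exact: measurable_sum.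
  by apply: measurable_funM => //; exact: measurable_sum.
by apply: measurable_funM => //; apply: measurable_sum => u; exact: measurable_sum.
Qed.

Lemma measurable_dCov2 : measurable_fun setT (fun w => dCov2 (x^~ w) (y^~ w)).
Proof.
have mdist m (z : 'I_n -> T -> m.-tuple R) u v : (forall s, measurable_fun setT (z s)) ->
    measurable_fun setT (fun w => dist_mx (z^~ w) u v).
  by move=> mz; under eq_fun do rewrite mxE; exact: measurable_eucl_dist.
apply: measurable_funM => //; apply: measurable_sum => s.
under eq_fun do rewrite big_mkcond.
apply: measurable_sum => t; case: (s != t); last exact: measurable_cst.
by apply: measurable_funM; apply: measurable_Ucenter => u v; exact: mdist.
Qed.

End Measurability.

Section Fixed_dimensions.
Context (R : realType) d0 d (T0 : measurableType d0) (T : measurableType d) (n p q : nat).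
Context (P0 : probability T0 R) (P : probability T R).
Context (XY XY' : {RV P0 >-> (p.-tuple R * q.-tuple R)%type}).
Context (XYs : 'I_n -> {RV P >-> (p.-tuple R * q.-tuple R)%type}).
Hypothesis hcopy : independent_copy XY XY'.
Hypothesis hiid : iid_copies XYs XY.

Let X := fst \o XY.
Let X' := fst \o XY'.
Let Y := snd \o XY.
Let Y' := snd \o XY'.
Let cx := tau2 P0 X X'.
Let cy := tau2 P0 Y Y'.
Let tau := Num.sqrt cx * Num.sqrt cy.
Let xs s w := (XYs s w).1.
Let ys s w := (XYs s w).2.

Let mxs s : measurable_fun setT (xs s).
Proof. exact: measurableT_comp. Qed.

Let mys s : measurable_fun setT (ys s).
Proof. exact: measurableT_comp. Qed.

Hypotheses (n4 : (4 <= n)%N) (cx0 : 0 < cx) (cy0 : 0 < cy).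
Context (al be ga la : R).
Hypotheses (al0 : 0 <= al) (be0 : 0 <= be) (ga0 : 0 <= ga) (la0 : 0 <= la).
Hypothesis alE : ('E_P0[(fun w => relL P0 X X' w ^+ 2)%R] = (al ^+ 2)%:E)%E.
Hypothesis beE : ('E_P0[(fun w => relL P0 Y Y' w ^+ 2)%R] = (be ^+ 2)%:E)%E.
Hypothesis gaE : ('E_P0[(fun w => relL P0 X X' w ^+ 4)%R] = (ga ^+ 2)%:E)%E.
Hypothesis laE : ('E_P0[(fun w => relL P0 Y Y' w ^+ 4)%R] = (la ^+ 2)%:E)%E.

Lemma measurable_lead :
  measurable_fun setT (fun w => tau^-1 * sum_cov2 (xs^~ w) (ys^~ w)).
Proof. by apply: measurable_funM => //; exact: measurable_sum_cov2. Qed.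

Lemma measurable_remainder :
  measurable_fun setT
    (fun w => dCov2 (xs^~ w) (ys^~ w) - tau^-1 * sum_cov2 (xs^~ w) (ys^~ w)).
Proof.
by apply: measurable_funB; [exact: measurable_dCov2 | exact: measurable_lead].
Qed.

(** A single exceptional event [B] serves both estimates: it is the union of four Markov events of
    probability at most 1 / K, and outside it the deterministic bounds apply. *)
Lemma lead_remainder_tail_le (K : R) : 0 < K ->
  (P [set w | (3 * K * (tau * al * be) <
       `|tau^-1 * sum_cov2 (xs^~ w) (ys^~ w)|)%R] <= (4 / K)%:E)%E /\
  (P [set w | (3 * K * (tau * al * la + tau * ga * be + tau * ga * la) <
       `|dCov2 (xs^~ w) (ys^~ w) - tau^-1 * sum_cov2 (xs^~ w) (ys^~ w)|)%R]
     <= (4 / K)%:E)%E.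
Proof.
move=> K0.
have m1 : measurable_fun [set: (p.-tuple R * q.-tuple R)%type] fst by [].
have m2 : measurable_fun [set: (p.-tuple R * q.-tuple R)%type] snd by [].
have mrel m (c : R) (z : 'I_n -> T -> m.-tuple R) k : (forall s, measurable_fun setT (z s)) ->
    measurable_fun setT (fun w => \sum_s \sum_t rel_mx c (z^~ w) s t ^+ k).
  move=> mz; apply: measurable_sum => s; apply: measurable_sum => t.
  apply: measurable_funX; under eq_fun do rewrite mxE.
  case: eqP => _; first exact: measurable_cst.
  apply: measurable_funM => //; apply: measurable_funB => //; apply: measurable_funX.
  exact: measurable_eucl_dist.
pose bad m c (z : 'I_n -> T -> m.-tuple R) k e := [set w |
  K * (n%:R * (n%:R - 1) * e ^+ 2) < \sum_s \sum_t rel_mx c (z^~ w) s t ^+ k].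
have mbad m c z k e : (forall s, measurable_fun setT (z s)) -> measurable (@bad m c z k e).
  by move=> mz; apply: measurable_gt_set; exact: mrel.
pose B := (bad p cx xs 2 al `|` bad q cy ys 2 be) `|` (bad p cx xs 4 ga `|` bad q cy ys 4 la).
have mB : measurable B by apply: measurableU; apply: measurableU; exact: mbad.
have PB : (P B <= (4 / K)%:E)%E.
  apply: le_trans (measureU2 _ _ _) _; [by apply: measurableU; exact: mbad..|].
  have -> : ((4 / K)%:E = (K^-1%:E + K^-1%:E) + (K^-1%:E + K^-1%:E))%E.
    by rewrite -!EFinD; congr EFin; ring.
  apply: leeD; (apply: le_trans (measureU2 _ _ _) _; [exact: mbad..|]); apply: leeD.
  - exact: (rel_mx_tail_le hcopy hiid m1 (k := 2) isT isT K0 alE).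
  - exact: (rel_mx_tail_le hcopy hiid m2 (k := 2) isT isT K0 beE).
  - exact: (rel_mx_tail_le hcopy hiid m1 (k := 4) isT isT K0 gaE).
  - exact: (rel_mx_tail_le hcopy hiid m2 (k := 4) isT isT K0 laE).
have good w : ~ B w ->
    [/\ \sum_s \sum_t rel_mx cx (xs^~ w) s t ^+ 2 <= K * (n%:R * (n%:R - 1) * al ^+ 2),
        \sum_s \sum_t rel_mx cy (ys^~ w) s t ^+ 2 <= K * (n%:R * (n%:R - 1) * be ^+ 2),
        \sum_s \sum_t rel_mx cx (xs^~ w) s t ^+ 4 <= K * (n%:R * (n%:R - 1) * ga ^+ 2) &
        \sum_s \sum_t rel_mx cy (ys^~ w) s t ^+ 4 <= K * (n%:R * (n%:R - 1) * la ^+ 2)].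
  move=> nB; split; rewrite leNgt; apply/negP => bw; apply: nB.
  - by left; left.
  - by left; right.
  - by right; left.
  - by right; right.
split; apply: le_trans PB; apply: le_measure; rewrite ?inE //.
- apply: measurable_gt_set; apply: measurableT_comp => //; exact: measurable_lead.
- move=> w /=; apply: contraPP => /good[G1 G2 G3 G4]; apply/negP; rewrite -leNgt.
  by apply: norm_lead_le => //; exact: ltW.
- apply: measurable_gt_set; apply: measurableT_comp => //; exact: measurable_remainder.
- move=> w /=; apply: contraPP => /good[G1 G2 G3 G4]; apply/negP; rewrite -leNgt.
  by apply: norm_remainder_le => //; exact: ltW.
Qed.

End Fixed_dimensions.

(** * Passage to the limit *)

Lemma bigOp_littleop1 (R : realType) (d : nat -> measure_display)
    (T : forall k, measurableType (d k)) (P : forall k, probability (T k) R)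
    (Z : forall k, T k -> R) (r : nat -> R) :
  (forall k, measurable_fun setT (Z k)) -> bigOp P Z r -> r k @[k --> \oo] --> 0 ->
  littleop1 P Z.
Proof.
move=> mZ Zr r0 eps eps0.
have mset k (c : R) : measurable [set w | c < `|Z k w|].
  by apply: measurable_gt_set; exact: measurableT_comp.
apply/fine_cvgP; split; first by apply: nearW => k; rewrite fin_num_measure.
apply/cvgr0Pnorm_le => e e0; have [M Mle] := Zr e e0.
(* [M] may be zero or negative, so the threshold for [r k] is obtained by dividing by |M| + 1. Once
   [M * |r k| <= eps], the event |Z| > eps lies in the one controlled by [Zr]. *)
have M1 : 0 < `|M| + 1 by rewrite ltr_wpDl.
have small : \forall k \near \oo, `|r k| <= eps / (`|M| + 1).
  by move/cvgr0Pnorm_le: r0; apply; rewrite divr_gt0.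
near=> k.
have Pk : (P k [set w | (M * `|r k| < `|Z k w|)%R] <= e%:E)%E by near: k.
have rk : `|r k| <= eps / (`|M| + 1) by near: k.
have Mr : M * `|r k| <= eps.
  rewrite (le_trans (ler_wpM2r (normr_ge0 _) (ler_norm M))) //.
  rewrite (@le_trans _ _ ((`|M| + 1) * `|r k|)) ?ler_wpM2r ?lerDl //.
  by rewrite mulrC -ler_pdivlMr.
rewrite ger0_norm ?fine_ge0 // -lee_fin fineK ?fin_num_measure //.
apply: le_trans Pk; apply: le_measure; rewrite ?inE //.
by move=> w /=; exact: le_lt_trans.
Unshelve. all: by end_near.
Qed.

Theorem theorem3p1p1 (R : realType)
  (* (X, Y) and its independent copy (X', Y'), for each p, q *)
  (d0 : nat -> nat -> measure_display)
  (T0 : forall p q, measurableType (d0 p q))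
  (P0 : forall p q, probability (T0 p q) R)
  (XY XY' : forall p q, {RV (P0 p q) >-> (p.-tuple R * q.-tuple R)%type})
  (hcopy : forall p q, independent_copy (XY p q) (XY' p q))
  (* the sample (X_1, Y_1), ..., (X_n, Y_n), for each n, p, q *)
  (d : nat -> nat -> nat -> measure_display)
  (T : forall n p q, measurableType (d n p q))
  (P : forall n p q, probability (T n p q) R)
  (XYs : forall n p q, 'I_n -> {RV (P n p q) >-> (p.-tuple R * q.-tuple R)%type})
  (hiid : forall n p q, iid_copies (XYs n p q) (XY p q))
  (* moment bounds, uniform in p, q *)
  (a b a' b' : R) (ha : 0 < a) (ha' : 0 < a')
  (hvarX : forall p q (i : 'I_p),
     (a%:E <= 'V_(P0 p q)[(fun w => tnth (XY p q w).1 i)%R])%E)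
  (hmomX : forall p q (i : 'I_p),
     ('E_(P0 p q)[(fun w => tnth (XY p q w).1 i ^+ 2)%R] <= b%:E)%E)
  (hvarY : forall p q (j : 'I_q),
     (a'%:E <= 'V_(P0 p q)[(fun w => tnth (XY p q w).2 j)%R])%E)
  (hmomY : forall p q (j : 'I_q),
     ('E_(P0 p q)[(fun w => tnth (XY p q w).2 j ^+ 2)%R] <= b'%:E)%E)
  (* the regime n /\ p /\ q --> oo *)
  (n_ p_ q_ : nat -> nat)
  (hreg : (fun k => minn (minn (n_ k) (p_ k)) (q_ k)) @ \oo --> \oo) :
  let X p q w := (XY p q w).1 in
  let Y p q w := (XY p q w).2 in
  let X' p q w := (XY' p q w).1 in
  let Y' p q w := (XY' p q w).2 in
  let tauX p q := Num.sqrt (tau2 (P0 p q) (X p q) (X' p q)) in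
  let tauY p q := Num.sqrt (tau2 (P0 p q) (Y p q) (Y' p q)) in
  let tau p q := tauX p q * tauY p q in
  let LX p q := relL (P0 p q) (X p q) (X' p q) in
  let LY p q := relL (P0 p q) (Y p q) (Y' p q) in
  let dCov n p q (w : T n p q) :=
    dCov2 (fun s => (XYs n p q s w).1) (fun s => (XYs n p q s w).2) in
  let lead n p q (w : T n p q) :=
    (tau p q)^-1 * sum_cov2 (fun s => (XYs n p q s w).1) (fun s => (XYs n p q s w).2) in
  let Rem n p q (w : T n p q) := dCov n p q w - lead n p q w in
  (forall n p q (w : T n p q), (4 <= n)%N -> (0 < p)%N -> (0 < q)%N ->
     dCov n p q w = lead n p q w + Rem n p q w)
  /\
  (forall alpha beta gamma lambda : nat -> nat -> R,
     (forall p q, [/\ 0 <= alpha p q, 0 <= beta p q,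
                      0 <= gamma p q & 0 <= lambda p q]) ->
     (forall p q, ('E_(P0 p q)[(fun w => LX p q w ^+ 2)%R])%E = (alpha p q ^+ 2)%:E) ->
     (forall p q, ('E_(P0 p q)[(fun w => LY p q w ^+ 2)%R])%E = (beta p q ^+ 2)%:E) ->
     (forall p q, ('E_(P0 p q)[(fun w => LX p q w ^+ 4)%R])%E = (gamma p q ^+ 2)%:E) ->
     (forall p q, ('E_(P0 p q)[(fun w => LY p q w ^+ 4)%R])%E = (lambda p q ^+ 2)%:E) ->
     let al k := alpha (p_ k) (q_ k) in
     let be k := beta (p_ k) (q_ k) in
     let ga k := gamma (p_ k) (q_ k) in
     let la k := lambda (p_ k) (q_ k) in
     let tX k := tauX (p_ k) (q_ k) in
     let tY k := tauY (p_ k) (q_ k) in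
     let t k := tau (p_ k) (q_ k) in
     (n_ k)%:R * al k @[k --> \oo] --> 0 ->
     (n_ k)%:R * be k @[k --> \oo] --> 0 ->
     tX k ^+ 2 * (al k * ga k + ga k ^+ 2) @[k --> \oo] --> 0 ->
     tY k ^+ 2 * (be k * la k + la k ^+ 2) @[k --> \oo] --> 0 ->
     t k * (al k * la k + ga k * be k + ga k * la k) @[k --> \oo] --> 0 ->
     [/\ bigOp (fun k => P (n_ k) (p_ k) (q_ k))
               (fun k => lead (n_ k) (p_ k) (q_ k))
               (fun k => t k * al k * be k),
         bigOp (fun k => P (n_ k) (p_ k) (q_ k))
               (fun k => Rem (n_ k) (p_ k) (q_ k))
               (fun k => t k * al k * la k + t k * ga k * be k + t k * ga k * la k)
       & littleop1 (fun k => P (n_ k) (p_ k) (q_ k))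
                   (fun k => Rem (n_ k) (p_ k) (q_ k))]).
Proof.
move=> X Y X' Y' tauX tauY tau LX LY dCov lead Rem; split.
  by move=> n p q w _ _ _; rewrite /Rem addrC subrK.
move=> alpha beta gamma lambda pos alE beE gaE laE al be ga la tX tY t _ _ _ _ rate0.
have cx0 p q : (0 < p)%N -> 0 < tau2 (P0 p q) (fst \o XY p q) (fst \o XY' p q).
  by apply: (tau2_gt0 (hcopy p q) (a := a) (b := b)) => //; exact: measurable_fst.
have cy0 p q : (0 < q)%N -> 0 < tau2 (P0 p q) (snd \o XY p q) (snd \o XY' p q).
  by apply: (tau2_gt0 (hcopy p q) (a := a') (b := b')) => //; exact: measurable_snd.
(* Eventually n is at least 4, as the U-statistics require, and p and q are positive, as [tau2_gt0]
   requires. *)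
have large : \forall k \near \oo, (4 <= minn (minn (n_ k) (p_ k)) (q_ k))%N.
  exact: hreg _ (nbhs_infty_ge 4).
have t0 k : 0 <= t k by rewrite mulr_ge0 // sqrtr_ge0.
have tails k (K : R) : 0 < K -> (4 <= minn (minn (n_ k) (p_ k)) (q_ k))%N ->
    (P (n_ k) (p_ k) (q_ k) [set w | (3 * K * (t k * al k * be k) <
       `|lead (n_ k) (p_ k) (q_ k) w|)%R] <= (4 / K)%:E)%E /\
    (P (n_ k) (p_ k) (q_ k) [set w |
       (3 * K * (t k * al k * la k + t k * ga k * be k + t k * ga k * la k) <
       `|Rem (n_ k) (p_ k) (q_ k) w|)%R] <= (4 / K)%:E)%E.
  move=> K0; rewrite !leq_min => /andP[/andP[n4 p4] q4].
  have [al0 be0 ga0 la0] := pos (p_ k) (q_ k).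
  apply: (lead_remainder_tail_le (hcopy _ _) (hiid _ _ _) n4 _ _ al0 be0 ga0 la0) => //.
  - by apply: cx0; exact: leq_trans p4.
  - by apply: cy0; exact: leq_trans q4.
  - exact: alE.
  - exact: beE.
  - exact: gaE.
  - exact: laE.
have rate_ge0 k : 0 <= t k * al k * be k /\
    0 <= t k * al k * la k + t k * ga k * be k + t k * ga k * la k.
  have [al0 be0 ga0 la0] : [/\ 0 <= al k, 0 <= be k, 0 <= ga k & 0 <= la k] := pos _ _.
  have mul3 (u v : R) : 0 <= u -> 0 <= v -> 0 <= t k * u * v.
    by move=> u0 v0; exact: mulr_ge0 (mulr_ge0 (t0 k) u0) v0.
  by split; [exact: mul3 | do 2?[apply: addr_ge0]; exact: mul3].
have four_div (eps : R) : 0 < eps -> 4 / (4 / eps) = eps.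
  by move=> eps0; field; rewrite gt_eqF.
have bigRem : bigOp (fun k => P (n_ k) (p_ k) (q_ k))
    (fun k => Rem (n_ k) (p_ k) (q_ k))
    (fun k => t k * al k * la k + t k * ga k * be k + t k * ga k * la k).
  (* The constant is 3 K with K = 4 / eps, chosen so that the tail bound 4 / K is exactly [eps]. *)
  move=> eps eps0; exists (3 * (4 / eps)).
  have K0 : 0 < 4 / eps by rewrite divr_gt0.
  apply: filterS large => k /(tails k _ K0)[_].
  by rewrite (ger0_norm (rate_ge0 k).2) four_div.
split=> //.
  move=> eps eps0; exists (3 * (4 / eps)).
  have K0 : 0 < 4 / eps by rewrite divr_gt0.
  apply: filterS large => k /(tails k _ K0)[+ _].
  by rewrite (ger0_norm (rate_ge0 k).1) four_div.
apply: bigOp_littleop1 bigRem _.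
  by move=> k; exact: measurable_remainder.
rewrite [X in X @ _ --> _](_ : _ = fun k => t k * (al k * la k + ga k * be k + ga k * la k)) //.
by apply/funext => k; ring.
Qed.
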